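(* Let $T>0$, $\sigma>0$ and let $n\in 2\mathbb{N}$ be a positive even integer. For an exponentially bounded Borel function $g:\mathbb{R}\to\mathbb{R}$ let $$u(t,x)=\mathbb{E}[g(x+\sigma W_{T-t})],\qquad u^n(t,x)=\mathbb{E}[g(x+\sigma W^n_{T-t})],\qquad (t,x)\in[0,T]\times\mathbb{R},$$ and let $t^n_k=\frac{2kT}{n}$ for integers $0\le k\le \frac n2$. (A) Suppose that $g\in GBV_{\mathrm{exp}}$ is given by the representation $g(x)=c+\mu([0,x))-\mu([x,0))+\sum_{i\ge1}\alpha_i\mathbf{1}_{\{x_i\}}(x)$ and that $\beta\ge0$ is such that $\int_{\mathbb{R}}e^{-\beta|x|}\,d|\mu|(x)+\sum_{i\ge1}|\alpha_i|e^{-\beta|x_i|}<\infty$. Then there is a constant $C>0$ depending only on $g$ such that, with $C_{\beta,\sigma,T}:=C\sqrt{T}\,e^{3\beta^2\sigma^2T}$, for all $(t,x)\in[0,T)\times\mathbb{R}$: (i) $\displaystyle |u^n(t,x)-u(t,x)|\le\frac{C_{\beta,\sigma,T}}{\sqrt{n(T-t)}}\,e^{\beta|x|}$ if $t\neq t^n_k$ for all integers $0\le k<\frac n2$; (ii) $\displaystyle |u^n(t^n_k,x)-u(t^n_k,x)|\le\frac{C_{\beta,\sigma,T}}{\sqrt{n(T-t^n_k)}}\,e^{\beta|x|}$ for all integers $0\le k<\frac n2$. (B) Let $\alpha\in(0,1]$, suppose that $g\in C^{0,\alpha}_{\mathrm{exp}}$, and let $\beta\ge0$ be such that for some $A\ge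 0$, $\sup_{x,y\in[-R,R],\,x\ne y}\frac{|g(x)-g(y)|}{|x-y|^\alpha}\le Ae^{\beta R}$ for all $R>0$. Then there is a constant $C>0$ depending only on $g$ such that, with $C_{\beta,\sigma,T}:=(1+T)(2+\sigma)C e^{4(\beta+1)^2\sigma^2T}$, for all $(t,x)\in[0,T)\times\mathbb{R}$: (iii) $\displaystyle |u^n(t,x)-u(t,x)|\le\frac{C_{\beta,\sigma,T}}{n^{\alpha/2}(T-t^n_k)^{\alpha/2}}\,e^{(\beta+1)|x|}$ whenever $t\in[t^n_k,t^n_{k+1})$, $0\le k<\frac n2$.
   Context: $(W_t)_{t\ge0}$ is a standard Brownian motion. With $(\xi_i)_{i\ge1}$ i.i.d. Rademacher random variables ($\mathbb{P}(\xi_i=\pm1)=1/2$), $W^n_t:=\sqrt{T/n}\,\sum_{i=1}^{2\lceil t/(2T/n)\rceil}\xi_i$ for $t\in[0,T]$, where $\lceil\cdot\rceil$ is the ceiling function. A function $g$ is exponentially bounded if $|g(x)|\le Ae^{b|x|}$ for all $x\in\mathbb{R}$, for some constants $A,b\ge0$. Class $\mathcal{M}$: all set functions $\mu$ from the bounded Borel subsets of $\mathbb{R}$ to $\mathbb{R}$ that can be written as a difference $\mu=\mu^1-\mu^2$ of two measures $\mu^1,\mu^2:\mathcal{B}(\mathbb{R})\to[0,\infty]$ that are finite on compact sets. Each $\mu\in\mathcal{M}$ has a unique minimal decomposition $\mu=\mu^+-\mu^-$ (on bounded Borel sets) with $\mu^+,\mu^-$ mutually singular measures, and $|\mu|:=\mu^++\mu^-$,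 a measure on $\mathcal{B}(\mathbb{R})$. Class $GBV_{\mathrm{exp}}$: all $g:\mathbb{R}\to\mathbb{R}$ that can be represented as $g(x)=c+\mu([0,x))-\mu([x,0))+\sum_{i\ge1}\alpha_i\mathbf{1}_{\{x_i\}}(x)$, $x\in\mathbb{R}$ (with $[a,b)=\emptyset$ if $a\ge b$), where $c\in\mathbb{R}$, $\mu\in\mathcal{M}$, $(\alpha_i,x_i)_{i\ge1}\subset\mathbb{R}^2$ is countable with $x_i\ne x_j$ for $i\ne j$, and such that for some $\beta\ge0$, $\int_{\mathbb{R}}e^{-\beta|x|}d|\mu|(x)+\sum_{i\ge1}|\alpha_i|e^{-\beta|x_i|}<\infty$. Class $C^{0,\alpha}_{\mathrm{exp}}$: all $g:\mathbb{R}\to\mathbb{R}$ for which there exist $A,\beta\ge0$ such that for all $R>0$, $\sup_{x,y\in[-R,R],\,x\ne y}\frac{|g(x)-g(y)|}{|x-y|^\alpha}\le Ae^{\beta R}$.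
   Formalization: In (A) the constant C may depend on β as well as on g: one C for all admissible β fails for g = Σ k e^k 1_{k}, admissible for all β > 1 (T = σ = 1, n = 2, t = 0, x = k, β → 1). In (B) C may depend on g and α, but not on β. *)

(* Defs.v *)
From HB Require Import structures.
From mathcomp Require Import all_boot all_order all_algebra.
From mathcomp Require Import all_classical all_reals all_analysis.

Set Implicit Arguments.
Unset Strict Implicit.
Unset Printing Implicit Defensive.

Import Order.TTheory GRing.Theory Num.Theory.
Import numFieldNormedType.Exports.

Local Open Scope classical_set_scope.
Local Open Scope ring_scope.

Section probabilistic_notions.
Context {d : measure_display} {T : measurableType d} {R : realType}.
Variable P : probability T R.

Definition mutually_independent (I : eqType) (X : I -> T -> R) : Prop :=
  forall (s : seq I) (A : I -> set R), uniq s ->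
    (forall i, measurable (A i)) ->
    P (\bigcap_(i in [set` s]) (X i @^-1` A i)) =
    (\big[*%E/1%E]_(i <- s) P (X i @^-1` A i))%E.

(* The process is indexed by all of R; only its values at times t >= 0 are
   constrained. *)
Definition standard_brownian_motion (W : R -> {RV P >-> R}) : Prop :=
  [/\ {ae P, forall w, W 0 w = 0},
      (forall tau : nat -> R, 0 <= tau 0%N -> nondecreasing_seq tau ->
        mutually_independent (fun (k : nat) w => W (tau k.+1) w - W (tau k) w)),
      (forall s t : R, 0 <= s -> s < t -> forall A : set R, measurable A ->
        P ((fun w => W t w - W s w) @^-1` A) =
        normal_prob 0 (Num.sqrt (t - s)) A) &
      {ae P, forall w, {within `[0, +oo[, continuous (fun t : R => W t w)}}].

Definition iid_rademacher (xi : nat -> {RV P >-> R}) : Prop :=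
  mutually_independent (fun (i : nat) w => xi i w) /\
  forall i, P [set w | xi i w = 1] = (2^-1)%:E /\
            P [set w | xi i w = -1] = (2^-1)%:E.

(* W^n; the sequence is numbered from 0, so xi i is the (i+1)-st step. *)
Definition scaled_walk (xi : nat -> {RV P >-> R}) (S : R) (n : nat)
    (t : R) (w : T) : R :=
  Num.sqrt (S / n%:R) *
  \sum_(0 <= i < 2 * `|Num.ceil (t / (2 * S / n%:R))|) xi i w.

(* E[g(x + sigma X_{S-t})] for a process X; X = W gives u, X = W^n gives u^n. *)
Definition value_fun (g : R -> R) (sigma S : R) (X : R -> T -> R) (t x : R) :
    \bar R :=
  ('E_P[(fun w => g (x + sigma * X (S - t) w))%R])%E.

End probabilistic_notions.

Section function_classes.
Context {R : realType}.
Implicit Types (g : R -> R) (mu : set R -> R) (alpha beta : R).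

Definition exp_bounded g : Prop :=
  exists A b : R, [/\ 0 <= A, 0 <= b & forall x, `|g x| <= A * expR (b * `|x|)].

Definition finite_on_compacts (m : {measure set (measurableTypeR R) -> \bar R}) :
    Prop := forall K : set R, compact K -> (m K < +oo)%E.

(* mu = m1 - m2 on the bounded Borel sets; the values of mu on other sets are
   irrelevant. *)
Definition diff_on_bounded mu
    (m1 m2 : {measure set (measurableTypeR R) -> \bar R}) : Prop :=
  forall B : set R, measurable B -> bounded_set B ->
    (mu B)%:E = (m1 B - m2 B)%E.

Definition classM mu : Prop :=
  exists m1 m2 : {measure set (measurableTypeR R) -> \bar R},
    [/\ finite_on_compacts m1, finite_on_compacts m2 & diff_on_bounded mu m1 m2].

Definition mutually_singular
    (m1 m2 : {measure set (measurableTypeR R) -> \bar R}) : Prop :=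
  exists N : set R, [/\ measurable N, m1 N = 0%E & m2 (~` N) = 0%E].

Definition minimal_decomposition mu
    (mup mun : {measure set (measurableTypeR R) -> \bar R}) : Prop :=
  mutually_singular mup mun /\ diff_on_bounded mu mup mun.

(* A finite family of jumps is the case where all but finitely many of the
   weights a i vanish. *)
Definition GBV_representation g (c : R) mu (a xs : nat -> R) : Prop :=
  [/\ classM mu, injective xs &
      forall x, g x = c + mu `[0, x[%classic - mu `[x, 0[%classic
                      + limn (series (fun i => a i * \1_[set xs i] x))].

Definition GBV_weight_finite mu (a xs : nat -> R) beta : Prop :=
  exists mup mun : {measure set (measurableTypeR R) -> \bar R},
    minimal_decomposition mu mup mun /\
    (\int[measure_add mup mun]_y (expR (- (beta * `|y|)))%:E
     + \sum_(0 <= i <oo) (`|a i| * expR (- (beta * `|xs i|)))%:E < +oo)%E.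

Definition GBV_exp_with beta g : Prop :=
  exists (c : R) mu (a xs : nat -> R),
    GBV_representation g c mu a xs /\ GBV_weight_finite mu a xs beta.

Definition GBV_exp g : Prop :=
  exists2 beta, 0 <= beta & GBV_exp_with beta g.

Definition hoelder_seminorm alpha g (r : R) : \bar R :=
  ereal_sup [set z | exists x y : R,
    [/\ x \in `[- r, r], y \in `[- r, r], x != y &
        z = (`|g x - g y| / `|x - y| `^ alpha)%:E]].

Definition hoelder_exp_with alpha beta g : Prop :=
  exists2 A : R, 0 <= A & forall r : R, 0 < r ->
    (hoelder_seminorm alpha g r <= (A * expR (beta * r))%:E)%E.

Definition hoelder_exp alpha g : Prop :=
  exists2 beta, 0 <= beta & hoelder_exp_with alpha beta g.

End function_classes.

Definition grid {R : realType} (S : R) (n k : nat) : R :=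
  2 * k%:R * S / n%:R.

(* Main.v *)
Require Import Defs.
From HB Require Import structures.
From mathcomp Require Import all_boot all_order all_algebra.
From mathcomp Require Import all_classical all_reals all_analysis.
From mathcomp Require Import measurable_realfun.
From mathcomp Require Import ring lra zify.
Set Implicit Arguments.
Unset Strict Implicit.
Unset Printing Implicit Defensive.

Import Order.TTheory GRing.Theory Num.Theory.
Import numFieldNormedType.Exports.
Local Open Scope classical_set_scope.
Local Open Scope ring_scope.

(** Write theta = S - t for the time left before the horizon S, m for the
    number of pairs of steps taken by the walk, h = 2 sqrt (S / n), and
    V = 2 theta / h^2.  The walk then sits on the lattice h Z, its position
    after 2 m steps being z h with probability q z = binomial (2 m, m + z) / 4^m,
    while the Brownian motion has a centred Gaussian density p of variance
    theta.  The definition of m by a ceiling says exactly that m - 1 < V <= m,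
    so both laws have nearly the same variance, and n being even gives
    2 m <= n.

    Spread the mass q z uniformly over the cell [z h, (z + 1) h[.  Then
    E g(x + sigma walk) - E g(x + sigma Brownian) is the integral over w of
      g(x + sigma w) * (q(floor (w / h)) / h - p w)
      + (g(x + sigma h floor (w / h)) - g(x + sigma w)) * q(floor (w / h)) / h.
    The first term is controlled by a local limit theorem with error O(1/m) and
    Gaussian decay ([local_limit]): its integral against an exponentially
    growing g is O(1 / sqrt m).  The second term is at most the sum over the
    lattice of q z times the oscillation of g on the image of the cell z.  When
    g has bounded variation with weight exp(- beta |y|), the oscillations are
    dominated by a measure, hence summable, and q = O(1 / sqrt m) gives the rate
    ([GBV_rate]); when g is Hoelder of order alpha, each oscillation is
    O(h^alpha) and q has total mass 1 ([hoelder_rate]).  The exponential weights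
    cost only factors exp(b^2 sigma^2 h^2 m), because q and p decay like
    Gaussians and b |w| can be completed to a square; and h^2 m <= 2 S.

    The local limit theorem needs no Stirling formula.  The quotient of two
    consecutive binomial coefficients is (1 - s) / (1 + s), which agrees with
    exp(- 2 s) up to O(s^3), so q z / q 0 is compared with a Gaussian by
    induction on z ([binom_ratio_gauss]); the normalising constant q 0 then
    follows by integrating this comparison, since both the q z and the Gaussian
    density have known total mass ([central_walk_pmf_near_gauss]).  This is a
    total-variation estimate on the densities, so that neither distribution
    functions nor an exchange of integrals against the variation measure of g
    enters. *)

(** * Ratios of binomial coefficients against a Gaussian *)

Lemma le_of_derive_ge0 (R : realType) (f df : R -> R) (x : R) : 0 <= x ->
  (forall y, is_derive y (1:R) f (df y)) -> (forall y, 0 <= y <= x -> 0 <= df y) ->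
  f 0 <= f x.
Proof.
move=> x0 fd df0.
have [//|c + e] := @MVT_segment R f df 0 x x0 (fun y _ => fd y).
  apply: derivable_within_continuous => y _; exact: ex_derive.
rewrite in_itv/= => c0x; rewrite -subr_ge0 e; apply: mulr_ge0; first exact: df0.
by rewrite subr_ge0.
Qed.

Lemma expRN_le_quad (R : realType) (s : R) : 0 <= s -> expR (- (2 * s)) <= 1 - 2 * s + 2 * s ^+ 2.
Proof.
move=> s0; rewrite -subr_ge0.
pose f (y : R) := 1 - 2 * y + 2 * y ^+ 2 - expR (- (2 * y)).
have := @le_of_derive_ge0 R f (fun y => - 2 + 4 * y + 2 * expR (- (2 * y))) s s0.
rewrite {2 3}/f; rewrite !mulr0 expr0n mulr0 subr0 oppr0 expR0 addr0 subrr; apply.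
  move=> y; rewrite /f. apply: is_derive_eq.
  rewrite /GRing.scale/=. ring.
move=> y _; have := expR_ge1Dx (- (2 * y)). lra.
Qed.

(** The two sides have equal Taylor expansions up to order two, and the
    derivative of (1 + y) exp(- 2 y) + y is 1 - (1 + 2 y) exp(- 2 y) >= 0. *)
Lemma frac_le_expRN (R : realType) (s : R) : 0 <= s -> s <= 1 ->
  (1 - s) / (1 + s) <= expR (- (2 * s)).
Proof.
move=> s0 s1; rewrite ler_pdivrMr; last lra.
pose f (y : R) := (1 + y) * expR (- (2 * y)) + y.
have := @le_of_derive_ge0 R f (fun y => 1 - (1 + 2 * y) * expR (- (2 * y))) s s0.
rewrite {2 3}/f mulr0 oppr0 expR0 !addr0 mulr1 => h.
suff : 1 <= (1 + s) * expR (- (2 * s)) + s by lra.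
apply: h => y; first by rewrite /f; apply: is_derive_eq; rewrite /GRing.scale/=; ring.
move=> _; rewrite subr_ge0 expRN ler_pdivrMr ?expR_gt0// mul1r.
exact: expR_ge1Dx.
Qed.

Lemma expRN_sub_frac (R : realType) (s : R) : 0 <= s ->
  expR (- (2 * s)) - (1 - s) / (1 + s) <= 2 * s ^+ 3.
Proof.
move=> s0; have := expRN_le_quad s0 => h.
have p : 0 < 1 + s by lra.
have -> : 2 * s ^+ 3 = (2 * s ^+ 3 * (1 + s)) / (1 + s) by field; rewrite gt_eqF.
rewrite lerBlDr -mulrDl ler_pdivlMr//.
apply: (@le_trans _ _ ((1 - 2 * s + 2 * s ^+ 2) * (1 + s))); first by rewrite ler_wpM2r// ltW.
have : 0 <= s ^+ 4 by rewrite exprn_ge0.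
rewrite !exprS expr0; nra.
Qed.

Definition binom_ratio (R : realType) (m k : nat) : R :=
  'C(2 * m, m + k)%:R / 'C(2 * m, m)%:R.

Lemma central_binom_gt0 (R : realType) (m : nat) : 0 < ('C(2 * m, m)%:R : R).
Proof. by rewrite ltr0n bin_gt0 leq_pmull. Qed.

Lemma binom_ratio0 (R : realType) m : binom_ratio R m 0 = 1.
Proof. by rewrite /binom_ratio addn0 divff// gt_eqF// central_binom_gt0. Qed.

Lemma binom_ratio_ge0 (R : realType) m k : 0 <= binom_ratio R m k.
Proof. by rewrite /binom_ratio divr_ge0. Qed.

Lemma binom_ratio_gtn (R : realType) m k : (m < k)%N -> binom_ratio R m k = 0.
Proof. by move=> mk; rewrite /binom_ratio bin_small ?mul0r//; lia. Qed.

(** The half-integer shifts make the logarithm of the quotient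
    (m - k) / (m + k + 1) an odd function of s, which is why it differs from
    - 2 s only by O(s^3). *)
Lemma binom_ratioS (R : realType) m k : (k <= m)%N ->
  let s : R := (k%:R + 2^-1) / (m%:R + 2^-1) in
  binom_ratio R m k.+1 = binom_ratio R m k * ((1 - s) / (1 + s)).
Proof.
move=> km s; rewrite /binom_ratio mulrAC; congr (_ / _).
have mk : (m%:R + k%:R + 1 : R) != 0 by rewrite -natrD natr1 pnatr_eq0.
have -> : (1 - s) / (1 + s) = (m - k)%:R / (m + k.+1)%:R.
  rewrite natrB// natrD -natr1 addrA /s.
  have k0 : 0 <= k%:R :> R by []. have m0 : 0 <= m%:R :> R by [].
  field; rewrite mk !gt_eqF//; lra.
have /(congr1 (fun x => x%:R : R)) := mul_bin_left (2 * m) (m + k).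
have -> : (2 * m - (m + k) = m - k)%N by lia.
rewrite !natrM addnS => e.
by rewrite mulrA (mulrC 'C(_, _)%:R) -e mulrAC divff ?mul1r// pnatr_eq0.
Qed.

(** Induction on k: one step multiplies the ratio by b = (1 - s) / (1 + s) and
    the Gaussian by a = exp(- 2 s), so the error picks up G * (a - b), where
    0 <= a - b <= 2 s^3.  Dividing by a costs at most exp 2 as s <= 1, and the
    s^3 sum up to k^4 / M^3.  Beyond the range of the walk the ratio vanishes
    and k^4 / M^3 >= 1. *)
Lemma binom_ratio_gauss (R : realType) m k : (0 < m)%N ->
  let M : R := m%:R + 2^-1 in
  let G : R := expR (- (k%:R ^+ 2 / M)) in
  is_true (0 <= G - binom_ratio R m k <= 2 * expR 2 * G * (k%:R ^+ 4 / M ^+ 3)).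
Proof.
move=> m0 M G.
have M1 : 1 <= M.
  have : 1 <= m%:R :> R by rewrite ler1n.
  rewrite /M; lra.
have M0 : 0 < M by lra.
rewrite /G {G}; elim: k => [|k IH].
  by rewrite binom_ratio0 !expr0n/= !mul0r oppr0 expR0 mulr0 subrr lexx.
have [km|mk] := leqP k m; last first.
  rewrite binom_ratio_gtn; last lia.
  rewrite subr0 expR_ge0/= (mulrAC (2 * expR 2)).
  apply: ler_peMl; first exact: expR_ge0.
  rewrite -[leLHS]mul1r ler_pM//; first by have := expR_ge1Dx (2:R); lra.
  rewrite ler_pdivlMr ?exprn_gt0// mul1r.
  have Mk : M <= k.+1%:R.
    have : m%:R <= k%:R :> R by rewrite ler_nat ltnW.
    rewrite /M -(natr1 k); lra.
  apply: (@le_trans _ _ (k.+1%:R ^+ 3)); first by apply: lerXn2r; rewrite ?nnegrE ?(ltW M0).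
  by rewrite ler_weXn2l// ler1n.
set s : R := (k%:R + 2^-1) / M.
have k0 : 0 <= k%:R :> R by [].
have s0 : 0 <= s by apply: divr_ge0; [rewrite addr_ge0// invr_ge0|exact: ltW].
have s1 : s <= 1 by rewrite ler_pdivrMr// mul1r lerD2r ler_nat.
have a0 := frac_le_expRN s0 s1; have a1 := expRN_sub_frac s0.
rewrite binom_ratioS//= -/M -/s.
have Ge : expR (- (k.+1%:R ^+ 2 / M)) = expR (- (k%:R ^+ 2 / M)) * expR (- (2 * s)).
  by rewrite -expRD; congr expR; rewrite /s -(natr1 k); field; rewrite gt_eqF.
set a := expR (- (2 * s)) in a0 a1 Ge *.
set b := (1 - s) / (1 + s) in a0 a1 *.
have b0 : 0 <= b by apply: divr_ge0; lra.
set E := expR (- (k%:R ^+ 2 / M)) in IH Ge *.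
set r := binom_ratio R m k in IH *.
have r0 : 0 <= r by exact: binom_ratio_ge0.
have E0 : 0 <= E by exact: expR_ge0.
have a0' : 0 < a by exact: expR_gt0.
rewrite Ge; move: IH => /andP[IH1 IH2]; apply/andP; split; first by nra.
have e2a : 1 <= expR 2 * a by rewrite -expRD -{1}expR0 ler_expR; lra.
have -> : E * a - r * b = (E - r) * b + E * (a - b) by ring.
apply: (@le_trans _ _ (2 * expR 2 * E * (k%:R ^+ 4 / M ^+ 3) * a + E * a * expR 2 * (2 * s ^+ 3))).
  apply: lerD.
    apply: ler_pM => //.
  rewrite -!mulrA ler_wpM2l// mulrA (mulrC a) -[leLHS]mul1r ler_pM//; lra.
have -> : 2 * expR 2 * E * (k%:R ^+ 4 / M ^+ 3) * a + E * a * expR 2 * (2 * s ^+ 3) =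
  2 * expR 2 * (E * a) * (k%:R ^+ 4 / M ^+ 3 + s ^+ 3) by ring.
apply: ler_wpM2l; first by rewrite !mulr_ge0// ?expR_ge0// ltW.
have -> : k%:R ^+ 4 / M ^+ 3 + s ^+ 3 = (k%:R ^+ 4 + (k%:R + 2^-1) ^+ 3) / M ^+ 3.
  by rewrite /s expr_div_n mulrDl.
rewrite ler_pM2r ?invr_gt0 ?exprn_gt0// -(natr1 k).
rewrite !exprS expr0; nra.
Qed.

(** * The unnormalised local limit estimate *)

Lemma dist_expRN (R : realType) (a b : R) :
  `|expR (- a) - expR (- b)| <= `|a - b| * (expR (- a) + expR (- b)).
Proof.
wlog ab : a b / a <= b => [H|].
  have [|/ltW] := leP a b; first exact: H.
  by move=> ba; rewrite distrC (distrC a) (addrC (expR (- a))); exact: H.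
rewrite ger0_norm ?subr_ge0 ?ler_expR ?lerN2// distrC ger0_norm ?subr_ge0//.
have -> : expR (- b) = expR (- a) * expR (- (b - a)).
  by rewrite -expRD; congr expR; ring.
have := expR_gt0 (- a); have := expR_ge1Dx (- (b - a)).
have := expR_gt0 (- (b - a)); set e := expR _; set f := expR _ => *.
have : 0 <= f * (e - (1 - (b - a))) by apply: mulr_ge0; lra.
have : 0 <= (b - a) * (f * e) by rewrite !mulr_ge0//; lra.
nra.
Qed.

(** Here j stands for the absolute value of the integer part of a real number
    of absolute value u.  Three replacements are made, each of relative
    size at most O(1 / sqrt m) up to powers of u^2 / m, which are absorbed by giving away
    part of the Gaussian exponent: the ratio by exp(- j^2 / (m + 1/2)), j by u,
    and m + 1/2 by V. *)
Lemma local_limit_unnormalised (R : realType) (m j : nat) (V u : R) : (0 < m)%N ->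
  m%:R / 2 <= V -> V <= m%:R -> m%:R - 1 <= V -> 0 <= u -> `|j%:R - u| <= 1 ->
  `|binom_ratio R m j - expR (- (u ^+ 2 / V))| <=
    (144 * expR 10 + 40 * (expR 9 + 1)) / Num.sqrt m%:R * expR (- (u ^+ 2 / (2 * m%:R))).
Proof.
move=> m0 mV Vm V1 u0 ju.
have m1 : 1 <= m%:R :> R by rewrite ler1n.
have j0 : 0 <= j%:R :> R by [].
pose M : R := m%:R + 2^-1.
have M0 : 0 < M by rewrite /M; lra.
have V0 : 0 < V by lra.
(* a shift by at most 1 costs a tenth of the square and a constant *)
have juE : j%:R ^+ 2 >= 9 / 10 * u ^+ 2 - 9.
  have d1 : (j%:R - u) ^+ 2 <= 1 by rewrite -real_normK ?num_real ?expr_le1.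
  have := sqr_ge0 (u + 10 * (j%:R - u)); move: d1; rewrite !expr2; nra.
set S := Num.sqrt m%:R.
have S1 : 1 <= S by rewrite -[leLHS]sqrtr1 ler_wsqrtr.
have SS : S ^+ 2 = m%:R by rewrite sqr_sqrtr//; lra.
pose w := u ^+ 2 / m%:R.
have w0 : 0 <= w by rewrite divr_ge0 ?sqr_ge0//; lra.
have uM : w * (2 / 3) <= u ^+ 2 / M.
  rewrite /w -mulrA ler_wpM2l ?sqr_ge0// -[leRHS]mul1r ler_pdivlMr// (mulrC _^-1) mulrAC ler_pdivrMr; last lra.
  by rewrite /M; lra.
have jM : j%:R ^+ 2 / M >= 3 / 5 * w - 9.
  have : (9 / 10 * u ^+ 2 - 9) / M <= j%:R ^+ 2 / M by rewrite ler_wpM2r// invr_ge0 ltW.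
  have : 9 / M <= 9 by rewrite ler_pdivrMr// /M; lra.
  rewrite mulrBl -mulrA; lra.
have -> : expR (- (u ^+ 2 / (2 * m%:R))) = expR (- (w / 2)).
  by congr expR; rewrite /w; field; rewrite gt_eqF//; lra.
set G := expR (- (j%:R ^+ 2 / M)).
have G0 : 0 < G by exact: expR_gt0.
have part1 : `|binom_ratio R m j - G| <= 144 * expR 10 / S * expR (- (w / 2)).
  have /andP[r1 r2] := @binom_ratio_gauss R m j m0.
  rewrite distrC ger0_norm//; apply: (le_trans r2); rewrite -/M -/G.
  pose y := j%:R ^+ 2 / M.
  have y0 : 0 <= y by rewrite divr_ge0 ?sqr_ge0 ?ltW.
  have -> : j%:R ^+ 4 / M ^+ 3 = y ^+ 2 / M.
    by rewrite /y expr_div_n -exprM; field; rewrite gt_eqF.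
  (* 72 = 2 * 6 ^ 2, from exp x >= x ^ 2 / 2 at x = y / 6 *)
  have yb : y ^+ 2 <= 72 * expR (y / 6).
    have := @expR_ge1Dxn R (y / 6) 1; rewrite expr_div_n !factS fact0 !muln1.
    have : 0 <= y / 6 by lra.
    move=> /[swap]/[apply]; lra.
  have MS : M^-1 <= S^-1.
    rewrite lef_pV2 ?posrE//; last by lra.
    by rewrite /M -SS expr2; nra.
  have Ge : G * expR (y / 6) * expR 2 <= expR 10 * expR (- (w / 2)).
    rewrite /G -/y -!expRD ler_expR.
    move: jM; rewrite -/y; lra.
  rewrite -/y in jM.
  apply: (@le_trans _ _ (2 * expR 2 * G * (72 * expR (y / 6) / S))).
    rewrite ler_wpM2l//; first by rewrite !mulr_ge0 ?expR_ge0.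
    by apply: ler_pM => //; rewrite ?sqr_ge0// invr_ge0 ltW.
  have -> : 2 * expR 2 * G * (72 * expR (y / 6) / S) =
     144 * (G * expR (y / 6) * expR 2) / S by ring.
  rewrite (_ : 144 * expR 10 / S * _ = 144 * (expR 10 * expR (- (w / 2))) / S); last by ring.
  rewrite ler_wpM2r ?invr_ge0 ?ler_wpM2l//; lra.
have part2 : `|G - expR (- (u ^+ 2 / V))| <= 40 * (expR 9 + 1) / S * expR (- (w / 2)).
  apply: (le_trans (dist_expRN _ _)).
  have d1 : `|j%:R ^+ 2 / M - u ^+ 2 / V| <= (40 * expR (w / 10)) / S.
    have e : j%:R ^+ 2 / M - u ^+ 2 / V = (j%:R ^+ 2 - u ^+ 2) / M - u ^+ 2 * (M - V) / (V * M).
      by field; rewrite !gt_eqF.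
    rewrite e; apply: (le_trans (ler_normB _ _)).
    pose z := u / S.
    have z0 : 0 <= z by apply: divr_ge0; lra.
    have wz : w = z ^+ 2 by rewrite /w /z expr_div_n SS.
    have uz : u = z * S by rewrite /z divfK// gt_eqF//; lra.
    have b1 : `|(j%:R ^+ 2 - u ^+ 2) / M| <= (2 * z + 1) / S.
      have M0' : 0 <= M^-1 by rewrite invr_ge0 ltW.
      rewrite subr_sqr !normrM (ger0_norm M0').
      apply: (@le_trans _ _ ((2 * u + 1) / M)).
        apply: ler_wpM2r => //; rewrite -[leRHS]mul1r; apply: ler_pM => //.
        by move: ju; rewrite !ler_norml => /andP[? ?]; apply/andP; lra.
      rewrite ler_pdivrMr// mulrAC ler_pdivlMr; last lra.
      rewrite uz /M -SS.
      apply: (@le_trans _ _ ((2 * z + 1) * S * S)); last by rewrite -mulrA -expr2 ler_wpM2l//; lra.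
      by apply: ler_wpM2r; nra.
    have b2 : `|u ^+ 2 * (M - V) / (V * M)| <= 3 * z ^+ 2 / S.
      rewrite ger0_norm; last first.
        apply: divr_ge0; last by rewrite mulr_ge0 ?ltW.
        by apply: mulr_ge0; [exact: sqr_ge0|rewrite /M; lra].
      rewrite ler_pdivrMr ?mulr_gt0// uz exprMn SS.
      have SV : S <= 2 * V by move: mV; rewrite -SS expr2; nra.
      have h1 : S * (M - V) <= 3 * V.
        apply: (@le_trans _ _ (S * (3 / 2))).
          by rewrite ler_wpM2l//; [lra|rewrite /M; lra].
        lra.
      rewrite (mulrAC (3 * z ^+ 2)) ler_pdivlMr; last lra.
      have -> : z ^+ 2 * m%:R * (M - V) * S = z ^+ 2 * m%:R * (S * (M - V)) by ring.
      have -> : 3 * z ^+ 2 * (V * M) = z ^+ 2 * M * (3 * V) by ring.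
      apply: ler_pM => //.
      - by rewrite mulr_ge0 ?sqr_ge0//.
      - by rewrite mulr_ge0//; [lra|rewrite /M; lra].
      - by rewrite ler_wpM2l ?sqr_ge0// /M; lra.
    apply: (le_trans (lerD b1 b2)); rewrite -mulrDl ler_wpM2r ?invr_ge0//; first lra.
    have := expR_ge1Dx (w / 10); rewrite wz !expr2; nra.
  have d2 : G + expR (- (u ^+ 2 / V)) <= (expR 9 + 1) * expR (- (3 / 5 * w)).
    rewrite mulrDl mul1r; apply: lerD; first by rewrite -expRD ler_expR; lra.
    rewrite ler_expR lerN2; apply: (@le_trans _ _ w); first lra.
    by rewrite /w ler_wpM2l ?sqr_ge0// lef_pV2// posrE; lra.
  apply: (le_trans (ler_pM _ _ d1 d2)) => //; first by rewrite addr_ge0 ?expR_ge0.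
  have -> : 40 * expR (w / 10) / S * ((expR 9 + 1) * expR (- (3 / 5 * w))) =
    40 * (expR 9 + 1) / S * (expR (w / 10) * expR (- (3 / 5 * w))) by ring.
  by rewrite -expRD (_ : w / 10 - _ = - (w / 2))//; lra.
rewrite (le_trans (ler_distD G _ _))// (le_trans (lerD part1 part2))//.
by rewrite -mulrDl -mulrDl.
Qed.

(** * Gaussian integrals and step functions on a lattice *)

Section gauss.
Context (R : realType).
Local Notation mu := (@lebesgue_measure R).
Implicit Types (a b w : R).

Lemma measurable_gauss a : measurable_fun [set: R] (fun w : R => expR (- (w ^+ 2 / a))).
Proof.
apply: measurableT_comp => //; apply: measurableT_comp => //.
by apply: measurable_funM => //; exact: measurable_funX.
Qed.

Lemma normal_pdf_sqrtE (t : R) w : 0 < t ->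
  normal_pdf 0 (Num.sqrt t) w = expR (- (w ^+ 2 / (2 * t))) / Num.sqrt (2 * pi * t).
Proof.
move=> t0; rewrite normal_pdfE ?gt_eqF ?sqrtr_gt0//.
rewrite /normal_peak /normal_fun sqr_sqrtr ?ltW// subr0 mulrC.
rewrite mulNr (_ : t *+ 2 = 2 * t); last by rewrite mulr_natl.
by rewrite (_ : t * pi *+ 2 = 2 * pi * t)//; ring.
Qed.

Lemma integral_gauss a : 0 < a ->
  (\int[mu]_w (expR (- (w ^+ 2 / a)))%:E = (Num.sqrt (pi * a))%:E)%E.
Proof.
move=> a0; have a20 : 0 < a / 2 by lra.
have s0 : Num.sqrt (pi * a) != 0 by rewrite gt_eqF// sqrtr_gt0 mulr_gt0// pi_gt0.
transitivity ((\int[mu]_w ((Num.sqrt (pi * a))%:E * (normal_pdf 0 (Num.sqrt (a / 2)) w)%:E))%E).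
  apply: eq_integral => w _; rewrite normal_pdf_sqrtE// -EFinM; congr EFin.
  rewrite (_ : 2 * (a / 2) = a); last by field.
  rewrite (_ : 2 * pi * (a / 2) = pi * a); last by field.
  by rewrite mulrCA divff ?mulr1.
rewrite integralZl//; last exact: integrable_normal_pdf.
by rewrite integral_normal_pdf mule1.
Qed.

Lemma integrable_gauss a : 0 < a ->
  mu.-integrable [set: R] (EFin \o (fun w : R => expR (- (w ^+ 2 / a)))).
Proof.
move=> a0; apply/integrableP; split.
  by apply/measurable_EFinP; exact: measurable_gauss.
under eq_integral do rewrite /= ger0_norm ?expR_ge0//.
by rewrite integral_gauss// ltry.
Qed.

(** Completing the square: half of the Gaussian exponent absorbs the
    exponential growth. *)
Lemma expR_gauss_le b a w : 0 < a ->
  expR (b * `|w|) * expR (- (w ^+ 2 / (2 * a))) <=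
  expR (b ^+ 2 * a) * expR (- (w ^+ 2 / (4 * a))).
Proof.
move=> a0; rewrite -!expRD ler_expR.
have -> : w ^+ 2 = `|w| ^+ 2 by rewrite real_normK// num_real.
have : 0 <= (`|w| - 2 * a * b) ^+ 2 / (4 * a).
  by apply: divr_ge0; [exact: sqr_ge0|lra].
suff -> : (`|w| - 2 * a * b) ^+ 2 / (4 * a) = b ^+ 2 * a - `|w| ^+ 2 / (4 * a)
   - b * `|w| + `|w| ^+ 2 / (2 * a) by lra.
by field; rewrite gt_eqF.
Qed.

Lemma dist_integral_le d (T : measurableType d) (nu : {measure set T -> \bar R})
    (f g F : T -> R) :
  nu.-integrable [set: T] (EFin \o f) -> nu.-integrable [set: T] (EFin \o g) ->
  measurable_fun [set: T] F -> (forall x, `|f x - g x| <= F x) ->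
  (`| \int[nu]_x (f x)%:E - \int[nu]_x (g x)%:E | <= \int[nu]_x (F x)%:E)%E.
Proof.
move=> fi gi mF fgF; rewrite -integralB_EFin//.
have mfg : measurable_fun [set: T] (fun x => (f x)%:E - (g x)%:E)%E.
  by apply: emeasurable_funB; [exact: measurable_int fi|exact: measurable_int gi].
apply: (le_trans (le_abse_integral _ _ mfg)) => //.
apply: ge0_le_integral => //; first by exact: measurableT_comp.
- by apply/measurable_EFinP.
- by move=> x _; rewrite -EFinB /= lee_fin.
Qed.

End gauss.

Section cells.
Context (R : realType).
Local Notation mu := (@lebesgue_measure R).
Implicit Types (h w : R) (m : nat) (z : int) (F : int -> R).

Definition cell h z : set R := [set` `[z%:~R * h, (z + 1)%:~R * h[].

Lemma in_cell h z w : 0 < h -> cell h z w <-> Num.floor (w / h) = z.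
Proof.
move=> h0; rewrite /cell /= in_itv/= -ler_pdivlMr// -ltr_pdivrMr//.
split=> [/floor_def //|<-].
by rewrite floor_le floorD1_gt.
Qed.

Lemma measurable_cell h z : measurable (cell h z).
Proof. exact: measurable_itv. Qed.

Lemma measure_cell h z : 0 < h -> mu (cell h z) = h%:E.
Proof.
move=> h0; rewrite lebesgue_measure_itv/= lte_fin intrD mulrDl mul1r ltrDl h0.
by rewrite -EFinD; congr EFin; ring.
Qed.

Lemma integrable_cell h z : 0 < h ->
  mu.-integrable [set: R] (fun w => (\1_(cell h z) w)%:E).
Proof.
move=> h0; apply/integrableP; split.
  by apply/measurable_EFinP/measurable_indic; exact: measurable_cell.
under eq_integral do rewrite /= ger0_norm//.
rewrite integral_indic//; last exact: measurable_cell.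
by rewrite setIT [X in (X < _)%E](measure_cell z h0) ltry.
Qed.

Definition lattice_step h m F w : R :=
  \sum_(i < (2 * m).+1) F (i%:Z - m%:Z) * \1_(cell h (i%:Z - m%:Z)) w.

Lemma lattice_stepE h m F w : 0 < h -> let z := Num.floor (w / h) in
  lattice_step h m F w = if (absz z <= m)%N then F z else 0.
Proof.
move=> h0 z; rewrite /lattice_step.
have iE (i : 'I_(2 * m).+1) : \1_(cell h (i%:Z - m%:Z)) w = (i%:Z - m%:Z == z)%:R :> R.
  rewrite indicE; congr (nat_of_bool _)%:R; apply/idP/eqP.
    by rewrite inE => /(in_cell _ _ h0) e; rewrite /z e.
  by move=> e; rewrite inE; apply/(in_cell _ _ h0); rewrite e.
under eq_bigr do rewrite iE.
case: ifPn => zm; last first.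
  apply: big1 => i _; case: eqP; rewrite ?mulr0// => e.
  have := ltn_ord i; move: zm; rewrite -e; lia.
have im : (absz (z + m%:Z)%R < (2 * m).+1)%N by lia.
rewrite (bigD1 (Ordinal im))//= big1 ?addr0 => [|i ni].
  have -> : (absz (z + m%:Z))%:Z - m%:Z = z by lia.
  by rewrite eqxx mulr1.
case: eqP; rewrite ?mulr0// => e; case/negP: ni; apply/eqP/val_inj => /=; lia.
Qed.

Lemma measurable_lattice_step h m F : measurable_fun [set: R] (lattice_step h m F).
Proof.
apply: measurable_sum => i; apply: measurable_funM => //.
by apply: measurable_indic; exact: measurable_cell.
Qed.

Lemma integrable_lattice_step h m F : 0 < h ->
  mu.-integrable [set: R] (EFin \o lattice_step h m F).
Proof.
move=> h0; have -> : EFin \o lattice_step h m F = (fun w =>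
   \sum_(i < (2 * m).+1) (F (i%:Z - m%:Z) * \1_(cell h (i%:Z - m%:Z)) w)%:E)%E.
  by apply/funext => w; rewrite /= /lattice_step sumEFin.
apply: integrable_sum => // i _.
under eq_fun do rewrite EFinM.
by apply: integrableZl => //; exact: integrable_cell.
Qed.

Lemma integral_lattice_step h m F : 0 < h ->
  (\int[mu]_w (lattice_step h m F w)%:E =
   (h * \sum_(i < (2 * m).+1) F (i%:Z - m%:Z))%:E)%E.
Proof.
move=> h0; under eq_integral do rewrite /lattice_step -sumEFin.
have I (i : 'I_(2 * m).+1) := integrable_cell (i%:Z - m%:Z) h0.
rewrite integral_sum//=; last first.
  by move=> i; under eq_fun do rewrite EFinM; exact: integrableZl.
rewrite mulr_sumr -sumEFin; apply: eq_bigr => i _.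
under eq_integral do rewrite EFinM.
rewrite integralZl// integral_indic//; last exact: measurable_cell.
by rewrite setIT [X in (_ * X)%E](measure_cell _ h0) -EFinM mulrC.
Qed.

End cells.

(** * The local limit theorem for the simple random walk *)

Section walk_pmf.
Context (R : realType).
Local Notation mu := (@lebesgue_measure R).

Definition walk_pmf (m : nat) (z : int) : R := 'C(2 * m, m + absz z)%:R / 2 ^+ (2 * m).

Lemma walk_pmf_ge0 m z : 0 <= walk_pmf m z.
Proof. by rewrite /walk_pmf divr_ge0// exprn_ge0. Qed.

Lemma walk_pmf_index m (i : 'I_(2 * m).+1) :
  walk_pmf m (i%:Z - m%:Z) = 'C(2 * m, i)%:R / 2 ^+ (2 * m).
Proof.
rewrite /walk_pmf; have := ltn_ord i; case: (leqP m i) => mi li.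
  by congr ('C(_, _)%:R / _); lia.
rewrite -(@bin_sub _ i); last lia.
by congr ('C(_, _)%:R / _); lia.
Qed.

Lemma sum_walk_pmf m : \sum_(i < (2 * m).+1) walk_pmf m (i%:Z - m%:Z) = 1.
Proof.
under eq_bigr do rewrite walk_pmf_index.
rewrite -mulr_suml.
have -> : \sum_(i < (2 * m).+1) 'C(2 * m, i)%:R = 2 ^+ (2 * m) :> R.
  have := @exprDn R 1 1 (2 * m); rewrite -(natrD _ 1 1) => ->.
  by apply: eq_bigr => i _; rewrite !expr1n mulr1.
by rewrite divff// expf_neq0// pnatr_eq0.
Qed.

Lemma walk_pmfE m z : walk_pmf m z = walk_pmf m 0 * binom_ratio R m (absz z).
Proof.
rewrite /walk_pmf /binom_ratio absz0 addn0 mulrAC mulrCA divff ?mulr1//.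
by rewrite gt_eqF// central_binom_gt0.
Qed.

Lemma walk_pmf0_gt0 m : 0 < walk_pmf m 0.
Proof. by rewrite /walk_pmf absz0 addn0 divr_gt0 ?exprn_gt0 ?central_binom_gt0. Qed.

Lemma walk_pmf0S m : walk_pmf m.+1 0 = walk_pmf m 0 * ((2 * m + 1)%:R / (2 * m + 2)%:R).
Proof.
have b : ('C(2 * m.+1, m.+1) * m.+1 = 2 * (2 * m + 1) * 'C(2 * m, m))%N.
  have e1 := mul_bin_diag (2 * m).+2 m; have e2 := mul_bin_diag (2 * m).+1 m.
  have e3 : 'C((2 * m).+1, m) = 'C((2 * m).+1, m.+1).
    by rewrite -(@bin_sub _ m); [congr 'C(_, _); lia|lia].
  rewrite /= in e1; rewrite (_ : 2 * m.+1 = (2 * m).+2)%N; last lia.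
  rewrite /= in e2.
  rewrite -e3 in e2; nia.
rewrite /walk_pmf absz0 !addn0.
have {b}/(congr1 (fun x => x%:R : R)) := b.
rewrite !natrM => b.
have n1 : (m.+1%:R : R) != 0 by rewrite pnatr_eq0.
have -> : ('C(2 * m.+1, m.+1)%:R : R) = 2 * (2 * m + 1)%:R * 'C(2 * m, m)%:R / m.+1%:R.
  by rewrite -b mulfK.
have -> : (2 * m + 2)%:R = 2 * m.+1%:R :> R by rewrite -natrM; congr (_%:R); lia.
rewrite (_ : 2 * m.+1 = 2 * m + 2)%N; last lia.
by rewrite exprD; field; rewrite expf_neq0 ?pnatr_eq0 ?nat1r ?n1.
Qed.

(** A substitute for Stirling: passing from m to m + 1 multiplies the left side
    by (2 m + 1) (2 m + 3) / (2 m + 2)^2 <= 1. *)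
Lemma central_walk_pmf_le m : walk_pmf m 0 ^+ 2 * (2 * m + 1)%:R <= 1.
Proof.
elim: m => [|m IH]; first by rewrite /walk_pmf absz0 addn0 muln0 bin0 expr0 divr1 mulr1 expr1n.
rewrite walk_pmf0S exprMn.
apply: le_trans IH; rewrite -mulrA ler_wpM2l ?sqr_ge0//.
rewrite expr_div_n mulrAC ler_pdivrMr ?exprn_gt0 ?ltr0n ?addn2//.
by rewrite -!natrX -!natrM ler_nat; nia.
Qed.

Lemma walk_pmf0_le m : (0 < m)%N -> walk_pmf m 0 <= (Num.sqrt m%:R)^-1.
Proof.
move=> m0; have s0 : 0 < Num.sqrt m%:R :> R by rewrite sqrtr_gt0 ltr0n.
rewrite -[leRHS]mul1r ler_pdivlMr//.
rewrite -(@ler_sqr _ _ 1) ?nnegrE ?mulr_ge0 ?walk_pmf_ge0 ?sqrtr_ge0// expr1n.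
rewrite exprMn sqr_sqrtr//; apply: le_trans (central_walk_pmf_le m).
by rewrite ler_wpM2l ?sqr_ge0// ler_nat; lia.
Qed.

(** The sign of the error in [binom_ratio_gauss] gives Gaussian decay at once. *)
Lemma walk_pmf_le_gauss m z : (0 < m)%N ->
  walk_pmf m z <= (Num.sqrt m%:R)^-1 * expR (- (z%:~R ^+ 2 / (2 * m%:R))).
Proof.
move=> m0; rewrite walk_pmfE; apply: ler_pM; rewrite ?walk_pmf_ge0 ?binom_ratio_ge0//.
  exact: walk_pmf0_le.
have /andP[+ _] := @binom_ratio_gauss R m (absz z) m0; rewrite subr_ge0 => /le_trans; apply.
rewrite ler_expR lerN2 natr_absz intr_norm real_normK ?num_real//.
have m1 : 1 <= m%:R :> R by rewrite ler1n.
apply: ler_wpM2l; first exact: sqr_ge0.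
by rewrite lef_pV2 ?posrE; lra.
Qed.

End walk_pmf.

Section local_limit.
Context (R : realType).
Local Notation mu := (@lebesgue_measure R).

Let C1 : R := 144 * expR 10 + 40 * (expR 9 + 1).

Let C1_ge0 : 0 <= C1.
Proof. by rewrite /C1 addr_ge0 ?mulr_ge0 ?addr_ge0 ?expR_ge0. Qed.

Lemma dist_floor_norm (w : R) : `|(absz (Num.floor w))%:R - `|w| | <= 1.
Proof.
rewrite natr_absz intr_norm (le_trans (ler_dist_dist _ _))//.
have := floor_le w; have := floorD1_gt w; rewrite intrD => *.
by rewrite ler_norml; lra.
Qed.

Lemma ratio_step_near_gauss (m : nat) (V w : R) : (0 < m)%N ->
  m%:R / 2 <= V -> V <= m%:R -> m%:R - 1 <= V ->
  `|lattice_step 1 m (fun z => binom_ratio R m (absz z)) w - expR (- (w ^+ 2 / V))| <=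
    C1 / Num.sqrt m%:R * expR (- (w ^+ 2 / (2 * m%:R))).
Proof.
move=> m0 mV Vm V1; rewrite lattice_stepE// divr1.
have := @local_limit_unnormalised R m (absz (Num.floor w)) V `|w| m0 mV Vm V1
  (normr_ge0 _) (dist_floor_norm _).
rewrite real_normK ?num_real//; case: ifPn => //.
by rewrite -ltnNge => h; rewrite binom_ratio_gtn.
Qed.

(** The ratios of [binom_ratio] sum to the inverse of the central probability,
    and the Gaussian integrates to sqrt (pi V); integrating the unnormalised
    estimate over the line compares the two totals. *)
Lemma central_walk_pmf_near_gauss (m : nat) (V : R) : (0 < m)%N ->
  m%:R / 2 <= V -> V <= m%:R -> m%:R - 1 <= V ->
  `|(walk_pmf R m 0)^-1 - Num.sqrt (pi * V)| <= C1 * Num.sqrt (pi * 2).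
Proof.
move=> m0 mV Vm V1.
have m1 : 1 <= m%:R :> R by rewrite ler1n.
have V0 : 0 < V by lra.
pose F (w : R) := C1 / Num.sqrt m%:R * expR (- (w ^+ 2 / (2 * m%:R))).
have mF : measurable_fun [set: R] F by apply: measurable_funM => //; exact: measurable_gauss.
have := @dist_integral_le R _ _ mu _ _ F (@integrable_lattice_step R 1 m
  (fun z => binom_ratio R m (absz z)) ltr01) (integrable_gauss V0) mF
  (fun w => ratio_step_near_gauss w m0 mV Vm V1).
rewrite integral_lattice_step// integral_gauss// mul1r.
have -> : \sum_(i < (2 * m).+1) binom_ratio R m (absz (i%:Z - m%:Z)) = (walk_pmf R m 0)^-1.
  apply: (@mulfI _ (walk_pmf R m 0)); first by rewrite gt_eqF// walk_pmf0_gt0.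
  rewrite divff ?gt_eqF ?walk_pmf0_gt0// -(sum_walk_pmf R m) mulr_sumr.
  by apply: eq_bigr => i _; rewrite -walk_pmfE.
rewrite /F; under eq_integral do rewrite EFinM.
rewrite integralZl//; last by apply: integrable_gauss; lra.
rewrite integral_gauss; last lra.
rewrite -EFinB /= -EFinM lee_fin => /le_trans; apply.
rewrite mulrA sqrtrM; last by rewrite mulr_ge0// pi_ge0.
by rewrite mulrACA mulVf ?mulr1// gt_eqF// sqrtr_gt0; lra.
Qed.

(** Both the shape and the normalising constant are now known to relative
    precision O(1 / sqrt m), and the constants themselves are O(1 / sqrt m). *)
Lemma local_limit : exists2 C : R, 0 < C & forall (m : nat) (V w : R), (0 < m)%N ->
  m%:R / 2 <= V -> V <= m%:R -> m%:R - 1 <= V ->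
  `|lattice_step 1 m (walk_pmf R m) w - expR (- (w ^+ 2 / V)) / Num.sqrt (pi * V)| <=
    C / m%:R * expR (- (w ^+ 2 / (2 * m%:R))).
Proof.
pose C2 := C1 * Num.sqrt (pi * 2).
have C20 : 0 <= C2 by rewrite mulr_ge0.
exists (C1 + 2 * C2 + 1) => [|m V w m0 mV Vm V1]; first by have := C1_ge0; lra.
have m1 : 1 <= m%:R :> R by rewrite ler1n.
have V0 : 0 < V by lra.
have s0 : 0 < Num.sqrt m%:R :> R by rewrite sqrtr_gt0; lra.
set q := walk_pmf R m 0; set S := Num.sqrt (pi * V).
have q0 : 0 < q by exact: walk_pmf0_gt0.
have qs : q <= (Num.sqrt m%:R)^-1 by exact: walk_pmf0_le.
have S0 : 0 < S by rewrite sqrtr_gt0 mulr_gt0// pi_gt0.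
set E := expR (- (w ^+ 2 / V)).
have E0 : 0 <= E by exact: expR_ge0.
set G := expR (- (w ^+ 2 / (2 * m%:R))).
have EG : E <= G.
  by rewrite ler_expR lerN2 ler_wpM2l ?sqr_ge0// lef_pV2// ?posrE; lra.
have qS : `|q - S^-1| <= 2 * C2 / m%:R.
  have -> : q - S^-1 = - (q / S * (q^-1 - S)) by field; rewrite !gt_eqF.
  have := central_walk_pmf_near_gauss m0 mV Vm V1; rewrite -/q -/S -/C2 => h.
  rewrite normrN normrM ger0_norm ?divr_ge0 ?(ltW q0) ?(ltW S0)//.
  apply: (@le_trans _ _ (2 / m%:R * C2)); last by rewrite mulrAC.
  apply: ler_pM => //; first by rewrite divr_ge0 ?(ltW q0) ?(ltW S0).
  have Sm : Num.sqrt m%:R <= 2 * S.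
    have -> : 2 * S = Num.sqrt (4 * (pi * V)).
      rewrite sqrtrM// (_ : 4 = 2 ^+ 2) ?sqrtr_sqr ?ger0_norm//.
      by rewrite expr2; lra.
    rewrite ler_wsqrtr//; have := pi_ge2 R; nra.
  rewrite ler_pdivrMr// (le_trans qs)// -[leLHS]mul1r ler_pdivrMr//.
  have -> : 2 / m%:R * S * Num.sqrt m%:R = (2 * S) * Num.sqrt m%:R / m%:R by field; lra.
  rewrite ler_pdivlMr; last lra.
  rewrite mul1r -{1}(@sqr_sqrtr _ m%:R)// expr2 ler_pM2r//.
have step : lattice_step 1 m (walk_pmf R m) w =
    q * lattice_step 1 m (fun z => binom_ratio R m (absz z)) w.
  rewrite /lattice_step mulr_sumr; apply: eq_bigr => i _.
  by rewrite mulrA -walk_pmfE.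
rewrite step; set r := lattice_step _ _ _ _.
have -> : q * r - E / S = q * (r - E) + E * (q - S^-1) by ring.
apply: (le_trans (ler_normD _ _)).
rewrite (normrM q) (normrM E) (ger0_norm (ltW q0)) (ger0_norm E0).
have p1 : q * `|r - E| <= C1 / m%:R * G.
  have -> : C1 / m%:R * G = (Num.sqrt m%:R)^-1 * (C1 / Num.sqrt m%:R * G).
    have -> : m%:R^-1 = (Num.sqrt m%:R)^-1 * (Num.sqrt m%:R)^-1 :> R.
      by rewrite -expr2 exprVn sqr_sqrtr.
    ring.
  apply: ler_pM => //; [exact: ltW|].
  exact: ratio_step_near_gauss.
have p2 : E * `|q - S^-1| <= G * (2 * C2 / m%:R) by apply: ler_pM.
apply: (le_trans (lerD p1 p2)).
have -> : C1 / m%:R * G + G * (2 * C2 / m%:R) = (C1 + 2 * C2) / m%:R * G by ring.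
rewrite ler_wpM2r ?expR_ge0// ler_wpM2r ?invr_ge0//; lra.
Qed.

End local_limit.

(** * Comparison of walk and Gaussian expectations *)

Section compare.
Context (R : realType).
Local Notation mu := (@lebesgue_measure R).
Implicit Types (g : R -> R) (t x sigma h K b w : R) (m : nat).

Lemma growth_shift g K b sigma x w : 0 <= K -> 0 <= b -> 0 <= sigma ->
  (forall y, `|g y| <= K * expR (b * `|y|)) ->
  `|g (x + sigma * w)| <= K * expR (b * `|x|) * expR (b * sigma * `|w|).
Proof.
move=> K0 b0 s0 gK; apply: (le_trans (gK _)).
rewrite -mulrA ler_wpM2l// -expRD ler_expR -mulrA -mulrDr ler_wpM2l//.
by rewrite (le_trans (ler_normD _ _))// normrM (ger0_norm s0).
Qed.

Lemma measurable_shift g sigma x : measurable_fun [set: R] g ->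
  measurable_fun [set: R] (fun w : R => g (x + sigma * w)).
Proof.
by move=> mg; apply: measurableT_comp => //; apply: measurable_funD => //; apply: measurable_funM.
Qed.

Lemma growth_normal_pdf_le g K b sigma x t w : 0 < t -> 0 <= K -> 0 <= b -> 0 <= sigma ->
  (forall y, `|g y| <= K * expR (b * `|y|)) ->
  `|g (x + sigma * w) * normal_pdf 0 (Num.sqrt t) w| <=
   K * expR (b * `|x|) * expR (b ^+ 2 * sigma ^+ 2 * t) / Num.sqrt (2 * pi * t) *
   expR (- (w ^+ 2 / (4 * t))).
Proof.
move=> t0 K0 b0 s0 gK.
rewrite normrM (ger0_norm (normal_pdf_ge0 _ _ _)) normal_pdf_sqrtE//.
have S0 : 0 < Num.sqrt (2 * pi * t) by rewrite sqrtr_gt0 !mulr_gt0 ?pi_gt0.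
set S := Num.sqrt _ in S0 *.
have := growth_shift x w K0 b0 s0 gK.
have := expR_gauss_le (b * sigma) w t0.
rewrite exprMn => h1 h2.
apply: (@le_trans _ _ (K * expR (b * `|x|) * expR (b * sigma * `|w|) *
  (expR (- (w ^+ 2 / (2 * t))) / S))).
  by rewrite ler_wpM2r// divr_ge0 ?expR_ge0 ?(ltW S0).
rewrite (_ : _ * (_ / S) = K * expR (b * `|x|) / S *
  (expR (b * sigma * `|w|) * expR (- (w ^+ 2 / (2 * t))))); last by ring.
rewrite [leRHS](_ : _ = K * expR (b * `|x|) / S *
  (expR (b ^+ 2 * sigma ^+ 2 * t) * expR (- (w ^+ 2 / (4 * t))))); last by ring.
by rewrite ler_wpM2l// divr_ge0 ?(ltW S0)// mulr_ge0 ?expR_ge0.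
Qed.

Lemma measurable_growth_normal_pdf g sigma x t : measurable_fun [set: R] g ->
  measurable_fun [set: R] (fun w => g (x + sigma * w) * normal_pdf 0 (Num.sqrt t) w).
Proof.
move=> mg; apply: measurable_funM; first exact: measurable_shift.
exact: measurable_normal_pdf.
Qed.

Lemma integrable_growth_normal_pdf g K b sigma x t : 0 < t -> 0 <= K -> 0 <= b ->
  0 <= sigma -> measurable_fun [set: R] g ->
  (forall y, `|g y| <= K * expR (b * `|y|)) ->
  mu.-integrable [set: R]
    (EFin \o (fun w => g (x + sigma * w) * normal_pdf 0 (Num.sqrt t) w)).
Proof.
move=> t0 K0 b0 s0 mg gK.
pose D := K * expR (b * `|x|) * expR (b ^+ 2 * sigma ^+ 2 * t) / Num.sqrt (2 * pi * t).
have D0 : 0 <= D by rewrite divr_ge0 ?sqrtr_ge0// !mulr_ge0 ?expR_ge0.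
apply: (@le_integrable _ _ _ mu _ _ _ (fun w => D%:E * (expR (- (w ^+ 2 / (4 * t))))%:E)%E) => //.
- by apply/measurable_EFinP; exact: measurable_growth_normal_pdf.
- move=> w _; rewrite -EFinM /= lee_fin [leRHS]ger0_norm ?mulr_ge0 ?expR_ge0//.
  exact: growth_normal_pdf_le.
- by apply: integrableZl => //; apply: integrable_gauss; lra.
Qed.

Lemma integral_growth_normal_pdf_le g K b sigma x t : 0 < t -> 0 <= K -> 0 <= b ->
  0 <= sigma -> measurable_fun [set: R] g ->
  (forall y, `|g y| <= K * expR (b * `|y|)) ->
  (`|\int[mu]_w (g (x + sigma * w) * normal_pdf 0 (Num.sqrt t) w)%:E| <=
   (Num.sqrt 2 * K * expR (b * `|x|) * expR (b ^+ 2 * sigma ^+ 2 * t))%:E)%E.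
Proof.
move=> t0 K0 b0 s0 mg gK.
have S0 : 0 < Num.sqrt (2 * pi * t) by rewrite sqrtr_gt0 !mulr_gt0 ?pi_gt0.
pose D := K * expR (b * `|x|) * expR (b ^+ 2 * sigma ^+ 2 * t) / Num.sqrt (2 * pi * t).
have mint := measurable_growth_normal_pdf sigma x t mg.
apply: (le_trans (le_abse_integral _ _ _)) => //; first exact/measurable_EFinP.
apply: (@le_trans _ _ (\int[mu]_w (D%:E * (expR (- (w ^+ 2 / (4 * t))))%:E))%E).
  apply: ge0_le_integral => //.
  - by apply: measurableT_comp => //; exact/measurable_EFinP.
  - under eq_fun do rewrite -EFinM.
    by apply/measurable_EFinP/measurable_funM => //; exact: measurable_gauss.
  - by move=> w _; rewrite -EFinM /= lee_fin; exact: growth_normal_pdf_le.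
rewrite integralZl//; last by apply: integrable_gauss; lra.
rewrite integral_gauss; last lra.
rewrite -EFinM lee_fin /D.
rewrite (_ : pi * (4 * t) = 2 * (2 * pi * t)); last by ring.
rewrite (sqrtrM (2 * pi * t))//.
by rewrite le_eqVlt; apply/orP; left; apply/eqP; field; rewrite gt_eqF.
Qed.

Lemma lattice_step_scale h m (F : int -> R) w : 0 < h ->
  lattice_step h m F w = lattice_step 1 m F (w / h).
Proof. by move=> h0; rewrite !lattice_stepE// divr1. Qed.

(** The expectation of f at half the position of the simple random walk after
    2 m steps. *)
Definition walk_mean m (f : int -> R) : R :=
  \sum_(i < (2 * m).+1) walk_pmf R m (i%:Z - m%:Z) * f (i%:Z - m%:Z).

Lemma walk_mean_ge0 m (f : int -> R) : (forall z, (absz z <= m)%N -> 0 <= f z) ->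
  0 <= walk_mean m f.
Proof.
move=> f0; apply: sumr_ge0 => i _; apply: mulr_ge0; first exact: walk_pmf_ge0.
by apply: f0; have := ltn_ord i; lia.
Qed.

Lemma ler_walk_mean m (f f' : int -> R) : (forall z, (absz z <= m)%N -> f z <= f' z) ->
  walk_mean m f <= walk_mean m f'.
Proof.
move=> ff; apply: ler_sum => i _; apply: ler_wpM2l; first exact: walk_pmf_ge0.
by apply: ff; have := ltn_ord i; lia.
Qed.

Lemma ler_norm_walk_mean m (f : int -> R) : `|walk_mean m f| <= walk_mean m (fun z => `|f z|).
Proof.
apply: (le_trans (ler_norm_sum _ _ _)); apply: ler_sum => i _.
by rewrite normrM ger0_norm// walk_pmf_ge0.
Qed.

Lemma walk_mean_cst m c : walk_mean m (fun=> c) = c.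
Proof. by rewrite /walk_mean -mulr_suml sum_walk_pmf mul1r. Qed.

(** With a single pair of steps the Gaussian variance can be arbitrarily small
    and no local limit estimate is available, but the claimed error is then of
    order one and crude exponential bounds suffice. *)
Lemma walk_gauss_small_time : exists2 C : R, 0 < C &
  forall h t g K b sigma x, 0 < h -> 0 < t -> t <= h ^+ 2 ->
  0 <= K -> 0 <= b -> 0 <= sigma -> measurable_fun [set: R] g ->
  (forall y, `|g y| <= K * expR (b * `|y|)) ->
  (`| (walk_mean 1 (fun z => g (x + sigma * (z%:~R * h))))%:E
     - \int[mu]_w (g (x + sigma * w) * normal_pdf 0 (Num.sqrt t) w)%:E | <=
   (C * K * expR (b * `|x|) * expR (b ^+ 2 * sigma ^+ 2 * h ^+ 2))%:E)%E.
Proof.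
exists (expR 1 + Num.sqrt 2) => [|h t g K b sigma x h0 t0 th K0 b0 s0 mg gK].
  by rewrite ltr_pwDl ?expR_gt0 ?sqrtr_ge0.
apply: (le_trans (lee_abs_sub _ _)).
have -> : (expR 1 + Num.sqrt 2) * K * expR (b * `|x|) * expR (b ^+ 2 * sigma ^+ 2 * h ^+ 2)
  = K * expR (b * `|x|) * (expR 1 * expR (b ^+ 2 * sigma ^+ 2 * h ^+ 2)) +
   Num.sqrt 2 * K * expR (b * `|x|) * expR (b ^+ 2 * sigma ^+ 2 * h ^+ 2) by ring.
rewrite EFinD; apply: leeD.
  rewrite /= lee_fin (le_trans (ler_norm_walk_mean _ _))//.
  rewrite -[leRHS](walk_mean_cst 1); apply: ler_walk_mean => z z1.
  apply: (le_trans (growth_shift _ _ K0 b0 s0 gK)).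
  rewrite ler_wpM2l ?mulr_ge0 ?expR_ge0// -expRD ler_expR normrM (gtr0_norm h0).
  have zR : `|z%:~R : R| <= 1 by rewrite -intr_norm -natr_absz -[1]/(1%:R) ler_nat.
  set c := b * sigma * h.
  have c0 : 0 <= c by rewrite !mulr_ge0 // ltW.
  have : `|z%:~R : R| * c <= c by rewrite ler_piMl.
  rewrite (_ : b * sigma * (`|z%:~R| * h) = `|z%:~R : R| * c); last by rewrite /c; ring.
  rewrite (_ : b ^+ 2 * sigma ^+ 2 * h ^+ 2 = c ^+ 2); last by rewrite /c; ring.
  have := sqr_ge0 (c - 2^-1); rewrite !expr2; lra.
apply: (le_trans (integral_growth_normal_pdf_le _ t0 K0 b0 s0 mg gK)).
rewrite lee_fin ler_wpM2l ?mulr_ge0 ?expR_ge0 ?sqrtr_ge0//.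
by rewrite ler_expR ler_wpM2l ?mulr_ge0 ?sqr_ge0.
Qed.

(** The mass of each lattice point is spread over its cell, and the integrand
    is split into a density error, bounded by the local limit theorem, and an
    oscillation error on each cell. *)
Lemma walk_gauss_large_time : exists2 C : R, 0 < C &
  forall m h t g K b sigma x (osc : int -> R), (0 < m)%N -> 0 < h -> 0 < t ->
  m%:R / 2 <= 2 * t / h ^+ 2 -> m%:R - 1 <= 2 * t / h ^+ 2 -> 2 * t / h ^+ 2 <= m%:R ->
  0 <= K -> 0 <= b -> 0 <= sigma -> measurable_fun [set: R] g ->
  (forall y, `|g y| <= K * expR (b * `|y|)) ->
  (forall z w, cell h z w ->
     `|g (x + sigma * (z%:~R * h)) - g (x + sigma * w)| <= osc z) ->
  (`| (walk_mean m (fun z => g (x + sigma * (z%:~R * h))))%:E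
     - \int[mu]_w (g (x + sigma * w) * normal_pdf 0 (Num.sqrt t) w)%:E | <=
   (C * K * expR (b * `|x|) * expR (b ^+ 2 * sigma ^+ 2 * (h ^+ 2 * m%:R)) / Num.sqrt m%:R
    + walk_mean m osc)%:E)%E.
Proof.
have [C C0 LL] := local_limit R.
exists (C * Num.sqrt (pi * 4)) => [|m h t g K b sigma x osc m0 h0 t0 mV V1 Vm K0 b0 s0 mg gK oscP].
  by rewrite mulr_gt0// sqrtr_gt0 mulr_gt0// pi_gt0.
have m1 : 1 <= m%:R :> R by rewrite ler1n.
have hn : h != 0 by rewrite gt_eqF.
set V := 2 * t / h ^+ 2 in mV V1 Vm.
pose P := fun z : int => g (x + sigma * (z%:~R * h)).
pose f := lattice_step h m (fun z => walk_pmf R m z * P z / h).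
pose o := lattice_step h m (fun z => walk_pmf R m z * osc z / h).
have fi : mu.-integrable [set: R] (EFin \o f) by exact: integrable_lattice_step.
have oi : mu.-integrable [set: R] (EFin \o o) by exact: integrable_lattice_step.
have intE (F : int -> R) :
  (\int[mu]_w (lattice_step h m (fun z => walk_pmf R m z * F z / h) w)%:E = (walk_mean m F)%:E)%E.
  rewrite integral_lattice_step// mulr_sumr; congr EFin.
  by apply: eq_bigr => i _; rewrite mulrC divfK.
pose D := K * expR (b * `|x|) * (C / (m%:R * h)) * expR (b ^+ 2 * sigma ^+ 2 * (h ^+ 2 * m%:R)).
have D0 : 0 <= D.
  by rewrite !mulr_ge0 ?expR_ge0 ?invr_ge0 ?mulr_ge0// ltW.
pose A := h ^+ 2 * m%:R.
have A0 : 0 < A by rewrite mulr_gt0 ?exprn_gt0// ltr0n.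
pose F w := D * expR (- (w ^+ 2 / (4 * A))) + o w.
have mF : measurable_fun [set: R] F.
  apply: measurable_funD; last exact: measurable_lattice_step.
  by apply: measurable_funM => //; exact: measurable_gauss.
have pt w : `|f w - g (x + sigma * w) * normal_pdf 0 (Num.sqrt t) w| <= F w.
  set q := lattice_step h m (walk_pmf R m) w / h.
  set p := normal_pdf 0 (Num.sqrt t) w.
  have qp : `|q - p| <= C / (m%:R * h) * expR (- (w ^+ 2 / (2 * A))).
    have := LL m V (w / h) m0 mV Vm V1.
    rewrite -lattice_step_scale// => LLw.
    have -> : q - p = (lattice_step h m (walk_pmf R m) w -
        expR (- ((w / h) ^+ 2 / V)) / Num.sqrt (pi * V)) / h.
      rewrite mulrBl /q; congr (_ - _); rewrite /p normal_pdf_sqrtE//.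
      have -> : (w / h) ^+ 2 / V = w ^+ 2 / (2 * t).
        by rewrite /V; field; rewrite hn gt_eqF.
      have -> : 2 * pi * t = pi * V * h ^+ 2 by rewrite /V; field.
      have pV : 0 <= pi * V by rewrite mulr_ge0 ?pi_ge0//; lra.
      by rewrite (sqrtrM (h ^+ 2) pV) sqrtr_sqr (gtr0_norm h0); field; rewrite hn gt_eqF// sqrtr_gt0 mulr_gt0 ?pi_gt0//; lra.
    rewrite normrM normfV (gtr0_norm h0) ler_pdivrMr//.
    apply: (le_trans LLw); rewrite le_eqVlt; apply/orP; left; apply/eqP.
    have -> : (w / h) ^+ 2 / (2 * m%:R) = w ^+ 2 / (2 * A).
      by rewrite /A; field; rewrite hn pnatr_eq0 -lt0n m0.
    by field; rewrite hn pnatr_eq0 -lt0n m0.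
  have q0 : 0 <= q.
    rewrite /q divr_ge0 ?(ltW h0)// lattice_stepE//.
    by case: ifP => // _; exact: walk_pmf_ge0.
  have fq : `|f w - q * g (x + sigma * w)| <= o w.
    rewrite /f /o /q !lattice_stepE//; case: ifPn => zm; last by rewrite !mul0r subr0 normr0.
    set z := Num.floor _.
    have zw : cell h z w by apply/in_cell.
    have -> : walk_pmf R m z * P z / h - walk_pmf R m z / h * g (x + sigma * w) =
      walk_pmf R m z / h * (P z - g (x + sigma * w)) by ring.
    rewrite normrM ger0_norm ?divr_ge0 ?walk_pmf_ge0 ?(ltW h0)// [leRHS]mulrAC.
    apply: ler_wpM2l; first by rewrite divr_ge0 ?walk_pmf_ge0 ?(ltW h0).
    exact: oscP.
  have -> : f w - g (x + sigma * w) * p =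
    g (x + sigma * w) * (q - p) + (f w - q * g (x + sigma * w)) by ring.
  rewrite /F; apply: (le_trans (ler_normD _ _)); apply: lerD => //.
  rewrite normrM.
  apply: (@le_trans _ _ (K * expR (b * `|x|) * expR (b * sigma * `|w|) *
     (C / (m%:R * h) * expR (- (w ^+ 2 / (2 * A)))))).
    by apply: ler_pM => //; exact: growth_shift.
  have E := expR_gauss_le (b * sigma) w A0.
  rewrite exprMn in E.
  rewrite (_ : _ * _ = K * expR (b * `|x|) * (C / (m%:R * h)) *
     (expR (b * sigma * `|w|) * expR (- (w ^+ 2 / (2 * A))))); last by ring.
  rewrite /D -[leRHS]mulrA ler_wpM2l// !mulr_ge0 ?expR_ge0 ?invr_ge0 ?mulr_ge0// ltW//.
have gi := integrable_growth_normal_pdf x t0 K0 b0 s0 mg gK.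
have := dist_integral_le fi gi mF pt.
rewrite intE => /le_trans; apply.
have -> : (\int[mu]_w (F w)%:E = \int[mu]_w (D%:E * (expR (- (w ^+ 2 / (4 * A))))%:E) +
    \int[mu]_w (o w)%:E)%E.
  rewrite -integralD//.
  - by apply: integrableZl => //; apply: integrable_gauss; lra.
rewrite intE integralZl//; last by apply: integrable_gauss; lra.
rewrite integral_gauss; last lra.
rewrite -EFinM -EFinD lee_fin lerD2r le_eqVlt; apply/orP; left; apply/eqP.
rewrite (_ : pi * (4 * A) = pi * 4 * (h ^+ 2 * m%:R)); last by rewrite /A; ring.
rewrite sqrtrM; last by rewrite mulr_ge0 ?pi_ge0.
rewrite (sqrtrM m%:R) ?sqr_ge0// sqrtr_sqr (gtr0_norm h0) /D.
have s1 : Num.sqrt m%:R != 0 :> R by rewrite gt_eqF// sqrtr_gt0; lra.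
rewrite invfM; have -> : m%:R^-1 = (Num.sqrt m%:R)^-1 * (Num.sqrt m%:R)^-1 :> R.
  by rewrite -expr2 exprVn sqr_sqrtr.
by field; rewrite hn s1.
Qed.

End compare.

(** When m >= 2 the bounds on V force V >= m / 2, so the local limit theorem
    applies; the only exception is m = 1 with V < 1/2. *)
Lemma walk_gauss_compare (R : realType) : exists2 C : R, 0 < C &
  forall m (h t : R) (g : R -> R) (K b sigma x : R) (osc : int -> R), (0 < m)%N -> 0 < h -> 0 < t ->
  m%:R - 1 <= 2 * t / h ^+ 2 -> 2 * t / h ^+ 2 <= m%:R ->
  0 <= K -> 0 <= b -> 0 <= sigma -> measurable_fun [set: R] g ->
  (forall y, `|g y| <= K * expR (b * `|y|)) ->
  (forall z w, cell h z w ->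
     `|g (x + sigma * (z%:~R * h)) - g (x + sigma * w)| <= osc z) ->
  (`| (walk_mean m (fun z => g (x + sigma * (z%:~R * h))))%:E
     - \int[@lebesgue_measure R]_w (g (x + sigma * w) * normal_pdf 0 (Num.sqrt t) w)%:E | <=
   (C * K * expR (b * `|x|) * expR (b ^+ 2 * sigma ^+ 2 * (h ^+ 2 * m%:R)) / Num.sqrt m%:R
    + walk_mean m osc)%:E)%E.
Proof.
have [C1 C10 small] := walk_gauss_small_time R.
have [C2 C20 large] := walk_gauss_large_time R.
exists (C1 + C2) => [|m h t g K b sigma x osc m0 h0 t0 V1 Vm K0 b0 s0 mg gK oscP]; first lra.
have osc0 z : 0 <= osc z.
  apply: le_trans (oscP z (z%:~R * h) _) => //.
  by rewrite /cell /= in_itv/= lexx ltr_pM2r// ltr_int ltrDl.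
have m1 : 1 <= m%:R :> R by rewrite ler1n.
have pos : 0 <= K * expR (b * `|x|) * expR (b ^+ 2 * sigma ^+ 2 * (h ^+ 2 * m%:R)) / Num.sqrt m%:R.
  by rewrite divr_ge0 ?sqrtr_ge0// !mulr_ge0 ?expR_ge0.
have scal (c d Q : R) : 0 <= Q -> c <= d -> c * Q <= d * Q by move=> *; exact: ler_wpM2r.
have [mV|mV] := leP (m%:R / 2) (2 * t / h ^+ 2).
  apply: (le_trans (large m h t g K b sigma x osc m0 h0 t0 mV V1 Vm K0 b0 s0 mg gK oscP)).
  rewrite lee_fin lerD2r; set Q := _ / _ in pos; have := scal C2 (C1 + C2) Q pos; rewrite /Q !mulrA; apply; lra.
have mE : m = 1%N.
  have : m%:R < 2 :> R by lra.
  by rewrite ltr_nat => m2; move: m0 m2; clear; lia.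
rewrite {}mE in V1 Vm pos mV *.
have th : t <= h ^+ 2.
  have h2 : 0 < h ^+ 2 by rewrite exprn_gt0.
  by move: Vm; rewrite ler_pdivrMr//; lra.
apply: (le_trans (small h t g K b sigma x h0 t0 th K0 b0 s0 mg gK)).
rewrite sqrtr1 divr1 mulr1 in pos *.
rewrite lee_fin -[leLHS]addr0; apply: lerD; last by apply: walk_mean_ge0 => z _.
set Q := _ * _ in pos; have := scal C1 (C1 + C2) Q pos; rewrite /Q !mulrA ?divr1; apply; lra.
Qed.

(** * Expectations of functions of the Brownian motion *)

Section normal_expectation.
Context (R : realType).
Local Notation mu := (@lebesgue_measure R).

Lemma ge0_integral_normal_prob (s : R) (f : R -> \bar R) :
  measurable_fun [set: R] f -> (forall x, 0 <= f x)%E ->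
  (\int[normal_prob 0 s]_x f x = \int[mu]_x (f x * (normal_pdf 0 s x)%:E))%E.
Proof.
move=> mf f0.
have dom := normal_prob_dominates (0 : R) s.
rewrite -(Radon_Nikodym_SigmaFinite.change_of_variables dom f0 measurableT mf).
have iRN := Radon_Nikodym_SigmaFinite.f_integrable dom.
have mpdf : measurable_fun [set: R] (fun x => (normal_pdf 0 s x)%:E).
  by apply/measurable_EFinP; exact: measurable_normal_pdf.
apply: ae_eq_integral => //.
- by apply: emeasurable_funM => //; exact: measurable_int iRN.
- exact: emeasurable_funM.
- apply: ae_eqe_mul2l; apply: integral_ae_eq => // E _ mE.
  by rewrite -(Radon_Nikodym_SigmaFinite.f_integral dom).
Qed.

Lemma integral_normal_prob (s : R) (f : R -> R) :
  measurable_fun [set: R] f ->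
  mu.-integrable [set: R] (EFin \o (fun x => f x * normal_pdf 0 s x)) ->
  (\int[normal_prob 0 s]_x (f x)%:E = \int[mu]_x (f x * normal_pdf 0 s x)%:E)%E /\
  (normal_prob 0 s).-integrable [set: R] (EFin \o f).
Proof.
move=> mf fi.
have mfE : measurable_fun [set: R] (EFin \o f) by exact/measurable_EFinP.
have fi' : (normal_prob 0 s).-integrable [set: R] (EFin \o f).
  apply/integrableP; split=> //.
  rewrite ge0_integral_normal_prob//; last exact: measurableT_comp.
  case/integrableP: fi => _; congr (_ < _)%E; apply: eq_integral => x _ /=.
  by rewrite -EFinM normrM (ger0_norm (normal_pdf_ge0 _ _ _)).
split=> //.
rewrite integralE [RHS]integralE; congr (_ - _)%E.
  rewrite ge0_integral_normal_prob//; last exact: measurable_funepos.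
  apply: eq_integral => x _; rewrite !funeposE -EFin_max -EFinM -EFin_max.
  by rewrite maxr_pMl ?normal_pdf_ge0// mul0r.
rewrite ge0_integral_normal_prob//; last exact: measurable_funeneg.
apply: eq_integral => x _; rewrite !funenegE -!EFinN -EFin_max -EFinM -EFin_max.
by rewrite maxr_pMl ?normal_pdf_ge0// mul0r mulNr.
Qed.

(** Stated for plain functions X with the law given set by set, which is how
    the increments of a Brownian motion are specified. *)
Lemma integral_of_law d (Omega : measurableType d) (P : probability Omega R)
    (X : Omega -> R) (nu : {measure set (measurableTypeR R) -> \bar R}) (f : R -> R) :
  measurable_fun [set: Omega] X -> measurable_fun [set: R] f ->
  (forall A : set R, measurable A -> P (X @^-1` A) = nu A) ->
  nu.-integrable [set: R] (EFin \o f) ->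
  (\int[P]_w (f (X w))%:E = \int[nu]_y (f y)%:E)%E.
Proof.
move=> mX mf Xlaw fi.
have mX' : measurable_fun [set: Omega] (X : Omega -> measurableTypeR R) by exact: mX.
pose mixin := @isMeasurableFun.Build _ _ Omega (measurableTypeR R) X mX'.
pose XX : {mfun Omega >-> measurableTypeR R} := MeasurableFun.Pack (MeasurableFun.Class mixin).
have law (A : set (measurableTypeR R)) : measurable A -> distribution P XX A = nu A.
  by move=> mA; rewrite /distribution /pushforward /= -Xlaw.
have mfE : measurable_fun [set: measurableTypeR R] (EFin \o f) by exact/measurable_EFinP.
have eqI (h : R -> \bar R) :
    (\int[nu]_y h y = \int[distribution P XX]_y h y)%E.
  by apply: eq_measure_integral => A mA _; rewrite -law.
rewrite eqI integral_distribution//.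
apply/integrableP; split; first by apply/measurable_EFinP; apply: (measurableT_comp mf).
rewrite -(@ge0_integral_distribution _ _ _ _ _ P XX (fun w => `|(f w)%:E|%E))//.
  by rewrite -eqI; case/integrableP: fi.
exact: measurableT_comp.
Qed.

Lemma value_fun_brownian d (Omega : measurableType d) (P : probability Omega R)
    (W : R -> {RV P >-> R}) (g : R -> R) (K b sigma S t x : R) :
  standard_brownian_motion W -> t < S -> measurable_fun [set: R] g ->
  0 <= K -> 0 <= b -> 0 <= sigma -> (forall y, `|g y| <= K * expR (b * `|y|)) ->
  (value_fun P g sigma S (fun t w => W t w) t x =
   \int[mu]_w (g (x + sigma * w) * normal_pdf 0 (Num.sqrt (S - t)) w)%:E)%E.
Proof.
move=> [W0 _ Wn _] tS mg K0 b0 s0 gK.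
have th0 : 0 < S - t by lra.
set f := fun w : R => g (x + sigma * w).
have mf : measurable_fun [set: R] f by exact: measurable_shift.
have := integrable_growth_normal_pdf x th0 K0 b0 s0 mg gK.
move=> /(integral_normal_prob mf)[<- fi].
pose X : Omega -> R := fun w => W (S - t) w - W 0 w.
have mX : measurable_fun [set: Omega] X by exact: measurable_funB.
rewrite /value_fun unlock.
transitivity (\int[P]_w (f (X w))%:E)%E.
  apply: ae_eq_integral => //.
  - by apply/measurable_EFinP; apply: (measurableT_comp mf).
  - by apply/measurable_EFinP; apply: (measurableT_comp mf).
  - by apply: filterS W0 => w W0w _; rewrite /f /X W0w subr0.
apply: integral_of_law => // A mA.
by have := Wn 0 (S - t) (lexx _) th0 A mA; rewrite subr0.
Qed.

End normal_expectation.

(** * Expectations of functions of the walk *)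

Section walk_expectation.
Context d (Omega : measurableType d) (R : realType) (P : probability Omega R).
Variable xi : nat -> {RV P >-> R}.
Hypothesis xiP : iid_rademacher xi.

Let sgn (c : bool) : R := if c then 1 else -1.

Lemma rademacher_sign_ae : {ae P, forall w, forall i, xi i w = 1 \/ xi i w = -1}.
Proof.
apply: (@ae_foralln _ _ _ P (fun i w => xi i w = 1 \/ xi i w = -1)) => i.
have [_ /(_ i)[p1 p2]] := xiP.
have m1 c : measurable [set w | xi i w = c].
  by have := measurable_funPT (xi i) measurableT _ (measurable_set1 c); rewrite setTI.
set B := [set w | xi i w = 1] `|` [set w | xi i w = -1].
have mB : measurable B by exact: measurableU.
have PB : P B = 1%E.
  have dis : [set w | xi i w = 1] `&` [set w | xi i w = -1] = set0.
    apply/seteqP; split => // w /= [-> /eqP].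
    by rewrite eq_sym eqNr oner_eq0.
  by rewrite (measureU P (m1 1) (m1 (-1)) dis) [X in (X + _)%E]p1 [X in (_ + X)%E]p2 -EFinD; congr EFin; field.
exists (~` B); split; first exact: measurableC.
  by rewrite [LHS](probability_setC P mB) PB subee.
by move=> w /= h [h1|h1]; apply: h; [left|right].
Qed.

Definition sign_event (N : nat) (c : nat -> bool) : set Omega :=
  \bigcap_(i in [set` iota 0 N]) (xi i @^-1` [set sgn (c i)]).

Lemma measurable_sign_event N c : measurable (sign_event N c).
Proof.
apply: bigcap_measurableType => i _.
by have := measurable_funPT (xi i) measurableT _ (measurable_set1 (sgn (c i))); rewrite setTI.
Qed.

Lemma probability_sign_event N c : P (sign_event N c) = (2 ^- N)%:E.
Proof.
have [ind half] := xiP.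
rewrite [LHS](ind (iota 0 N) (fun i => [set sgn (c i)])) ?iota_uniq//.
rewrite (eq_bigr (fun=> (2^-1)%:E)); last first.
  by move=> i _; have [] := half i; rewrite /sgn; case: (c i).
rewrite -[in RHS](size_iota 0 N); elim: (iota 0 N) => [|k s IH]; first by rewrite big_nil invr1.
by rewrite big_cons IH -EFinM /= exprS invfM.
Qed.

(** Up to a null set the sample space is the disjoint union of the events that
    prescribe all signs; such an event is coded by the set A of the indices of
    its positive steps, has probability 2^-N, and the walk is constant on it. *)
Lemma expectation_walk_sets (N : nat) (phi : R -> R) : measurable_fun [set: R] phi ->
  (\int[P]_w (phi (\sum_(0 <= i < N) xi i w))%:E =
   (\sum_(A : {set 'I_N}) 2 ^- N * phi (2 * #|A|%:R - N%:R))%:E)%E.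
Proof.
move=> mphi.
pose code (A : {set 'I_N}) (i : nat) : bool := if insub i is Some j then j \in A else false.
have codeE A (j : 'I_N) : code A j = (j \in A) by rewrite /code valK.
have mS : measurable_fun [set: Omega] (fun w => \sum_(0 <= i < N) xi i w).
  by apply: measurable_sum.
transitivity (\int[P]_w (\sum_(A : {set 'I_N})
    (phi (2 * #|A|%:R - N%:R))%:E * (\1_(sign_event N (code A)) w)%:E)%E)%E.
  apply: ae_eq_integral => //.
  - by apply/measurable_EFinP; exact: measurableT_comp.
  - apply: emeasurable_sum => A; apply: emeasurable_funM => //.
    by apply/measurable_EFinP/measurable_indic; exact: measurable_sign_event.
  apply: filterS rademacher_sign_ae => w xw _.
  pose A0 : {set 'I_N} := finset (fun i : 'I_N => xi i w == 1).
  have A0P i : (i < N)%N -> xi i w = sgn (code A0 i).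
    move=> iN; have := codeE A0 (Ordinal iN); rewrite /= inE /= => ->.
    case: (xw i) => ->; first by rewrite eqxx.
    by rewrite eqNr oner_eq0.
  have sumE : \sum_(0 <= i < N) xi i w = 2 * #|A0|%:R - N%:R.
    rewrite big_mkord.
    under eq_bigr => i _ do rewrite A0P// codeE.
    rewrite (bigID (mem A0))/= (eq_bigr (fun=> 1)); last by move=> i ->.
    rewrite [X in _ + X](eq_bigr (fun=> -1)); last by move=> i /negbTE ->.
    have cN : N%:R = #|A0|%:R + #|(fun i => i \notin A0) : pred 'I_N|%:R :> R.
      by rewrite -natrD -[in LHS](card_ord N) -(cardC (mem A0)).
    by rewrite !sumr_const cN mulNrn; ring.
  rewrite sumE (bigD1 A0)//= big1 => [|A AA0].
    rewrite indicE mem_set ?mule1 ?adde0// => i /=.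
    by rewrite mem_iota/= add0n => iN; exact: A0P.
  rewrite indicE memNset ?mule0// => wA; case/eqP: AA0; apply/setP => i.
  have := wA i; rewrite /= mem_iota/= add0n ltn_ord => /(_ isT).
  rewrite codeE inE => ->.
  by rewrite /sgn; case: ifP => _; rewrite ?eqxx// eqNr oner_eq0.
rewrite integral_sum//=; last first.
  move=> A; apply: integrableZl => //; apply: integrable_indic.
  exact: measurable_sign_event.
rewrite -sumEFin; apply: eq_bigr => A _.
have mA := measurable_sign_event N (code A).
rewrite integralZl//; last exact: integrable_indic.
by rewrite integral_indic// setIT [X in (_ * X)%E]probability_sign_event -EFinM mulrC.
Qed.

Lemma sum_sets_card (N : nat) (c : nat -> R) :
  \sum_(A : {set 'I_N}) c #|A| = \sum_(k < N.+1) 'C(N, k)%:R * c k.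
Proof.
rewrite (partition_big (fun A : {set 'I_N} => inord #|A| : 'I_N.+1) xpredT)//=.
apply: eq_bigr => k _.
have cardN (A : {set 'I_N}) : (#|A| < N.+1)%N.
  by rewrite ltnS (leq_trans (max_card _))// card_ord.
rewrite (eq_bigr (fun=> c k)) => [|A /eqP <-]; last by rewrite inordK.
rewrite sumr_const mulr_natl; congr (_ *+ _).
have := card_draws 'I_N k; rewrite card_ord => <-; apply: eq_card => A.
rewrite !inE unfold_in /=; apply/eqP/eqP => [<-|e]; first by rewrite inordK.
by rewrite e inord_val.
Qed.

Lemma expectation_walk (m : nat) (phi : R -> R) : measurable_fun [set: R] phi ->
  (\int[P]_w (phi (\sum_(0 <= i < 2 * m) xi i w))%:E =
   (walk_mean m (fun z => phi (2 * z%:~R)))%:E)%E.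
Proof.
move=> mphi; rewrite expectation_walk_sets//.
rewrite (sum_sets_card (2 * m) (fun k => 2 ^- (2 * m) * phi (2 * k%:R - (2 * m)%:R))).
congr EFin; apply: eq_bigr => i _; rewrite walk_pmf_index mulrA; congr (_ * phi _).
by rewrite intrB natrM -!pmulrn; ring.
Qed.

Lemma value_fun_walk (g : R -> R) (sigma S t x : R) (n : nat) :
  measurable_fun [set: R] g -> 
  let m := `|Num.ceil ((S - t) / (2 * S / n%:R))|%N in
  let h := 2 * Num.sqrt (S / n%:R) in
  value_fun P g sigma S (scaled_walk xi S n) t x =
   (walk_mean m (fun z => g (x + sigma * (z%:~R * h))))%:E.
Proof.
move=> mg m h; rewrite /value_fun unlock /scaled_walk -/m.
have mphi : measurable_fun [set: R] (fun s : R => g (x + sigma * (Num.sqrt (S / n%:R) * s))).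
  apply: measurableT_comp => //; apply: measurable_funD => //; apply: measurable_funM => //.
rewrite (expectation_walk m mphi); congr EFin; apply: eq_bigr => i _.
by congr (_ * g (x + sigma * _)); rewrite /h; ring.
Qed.

End walk_expectation.

(** The evenness of n enters here: it makes n./2 an upper bound of V, and hence
    of its ceiling m. *)
Lemma walk_steps_bounds (R : realType) (S t : R) (n : nat) :
  0 < S -> 0 <= t -> t < S -> (0 < n)%N -> ~~ odd n ->
  let m := `|Num.ceil ((S - t) / (2 * S / n%:R))|%N in
  let V := (S - t) / (2 * S / n%:R) in
  [/\ (0 < m)%N, (2 * m <= n)%N, m%:R - 1 < V & V <= m%:R].
Proof.
move=> S0 t0 tS n0 nodd m V.
have nR : 0 < n%:R :> R by rewrite ltr0n.
have V0 : 0 < V by rewrite !divr_gt0 ?mulr_gt0//; lra.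
have c0 : (0 < Num.ceil V)%R by rewrite ceil_gt0.
have mE : m%:R = (Num.ceil V)%:~R :> R.
  by rewrite /m -/V -[in RHS](gtz0_abs c0).
split.
- by rewrite /m -/V; lia.
- have Vn : V <= (n./2)%:R.
    rewrite /V invf_div mulrA ler_pdivrMr ?mulr_gt0//.
    have -> : n%:R = 2 * (n./2)%:R :> R by rewrite -natrM mul2n even_halfK.
    have : 0 <= t * (n./2)%:R by rewrite mulr_ge0.
    lra.
  have : (Num.ceil V <= (n./2)%:Z)%R by rewrite ceil_le_int.
  have := odd_double_half n; rewrite (negbTE nodd) /m -/V => *; lia.
- by rewrite mE; have := ceilB1_lt V; rewrite intrB; lra.
- by rewrite mE; exact: ceil_ge.
Qed.

(** * A measure dominating the increments of a function of bounded variation *)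

Section GBV.
Context (R : realType).
Notation meas := {measure set (measurableTypeR R) -> \bar R}.

Lemma diff_on_bounded_fin (mu : set R -> R) (m1 m2 : meas) (B : set R) :
  diff_on_bounded mu m1 m2 -> measurable B -> bounded_set B ->
  [/\ m1 B \is a fin_num, m2 B \is a fin_num & mu B = fine (m1 B) - fine (m2 B)].
Proof.
move=> H mB bB; have := H B mB bB.
have : (0 <= m1 B)%E by []. have : (0 <= m2 B)%E by [].
case: (m1 B) => [r1| |]; case: (m2 B) => [r2| |] //= _ _.
by rewrite -EFinB => -[->].
Qed.

Lemma bounded_set_itvco (a b : R) : bounded_set `[a, b[%classic.
Proof.
exists (`|a| + `|b|); split=> [|M abM x /=]; first by rewrite num_real.
rewrite in_itv/= => /andP[ax xb]; apply/ltW/(le_lt_trans _ abM).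
have := ler_norm b; have := lerNnormlW (lexx `|a|).
have := normr_ge0 a; have := normr_ge0 b; rewrite ler_norml; lra.
Qed.

Definition jump_measure (a xs : nat -> R) : meas :=
  mseries (fun i => mscale (NngNum (normr_ge0 (a i))) (dirac (xs i : measurableTypeR R))) 0.

Definition jump_part (a xs : nat -> R) (x : R) : R :=
  limn (series (fun i => a i * \1_[set xs i] x)).

(** The points xs are distinct, so at most one term of the series is nonzero. *)
Lemma jump_part_le (a xs : nat -> R) (u : R) : injective xs ->
  (`|jump_part a xs u|%:E <= jump_measure a xs [set u])%E.
Proof.
move=> xsI; have [[i xiu]|nu] := pselect (exists i, xs i = u); last first.
  have -> : jump_part a xs u = 0; last by rewrite normr0.
  apply/cvg_lim => //; apply: cvg_near_cst; near=> n.
  rewrite /series /= big1// => k _; rewrite indicE memNset ?mulr0//= => e.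
  by apply: nu; exists k.
have -> : jump_part a xs u = a i.
  apply/cvg_lim => //; apply: cvg_near_cst; near=> n.
  have ni : (i < n)%N by near: n; exact: nbhs_infty_gt.
  rewrite /series /= big_mkord (bigD1 (Ordinal ni))//= big1 => [|k ki].
    by rewrite indicE mem_set//= mulr1 addr0.
  rewrite indicE memNset ?mulr0//= -xiu => /xsI e.
  by case/negP: ki; apply/eqP/val_inj.
rewrite /jump_measure /= /mseries.
have T0 k : (0 <= mscale (NngNum (normr_ge0 (a k))) (dirac (xs k : measurableTypeR R)) [set u])%E by [].
apply: le_trans (nneseries_lim_ge i.+1 (fun k _ _ => T0 k)).
rewrite big_nat_recr//= -[leLHS]add0e; apply: leeD; first exact: sume_ge0.
by rewrite /mscale /= diracE mem_set// mule1.
Unshelve. all: by end_near. Qed.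

Lemma drift_increment (mu : set R -> R) (mup mun : meas) (u v : R) :
  diff_on_bounded mu mup mun -> u <= v ->
  mu `[0, v[%classic - mu `[v, 0[%classic - (mu `[0, u[%classic - mu `[u, 0[%classic) =
  mu `[u, v[%classic.
Proof.
move=> H uv.
have add (a b c : R) : a <= b -> b <= c ->
    mu `[a, c[%classic = mu `[a, b[%classic + mu `[b, c[%classic.
  move=> ab bc.
  have [p1 n1 ->] := diff_on_bounded_fin H (measurable_itv `[a, c[) (@bounded_set_itvco a c).
  have [p2 n2 ->] := diff_on_bounded_fin H (measurable_itv `[a, b[) (@bounded_set_itvco a b).
  have [p3 n3 ->] := diff_on_bounded_fin H (measurable_itv `[b, c[) (@bounded_set_itvco b c).
  have e (m : meas) : m `[a, c[%classic = (m `[a, b[%classic + m `[b, c[%classic)%E.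
    rewrite -measureU//.
    - by congr (m _); rewrite (@itv_bndbnd_setU _ _ (BLeft a) (BLeft b) (BLeft c)) ?bnd_simp.
    - apply/seteqP; split => // y /=; rewrite !in_itv/= => -[/andP[_ yb] /andP[by_ _]].
      by move: (lt_le_trans yb by_); rewrite ltxx.
  by rewrite !e !fineD//; ring.
have emp (a b : R) : b <= a -> mu `[a, b[%classic = 0.
  move=> ba.
  have [_ _ ->] := diff_on_bounded_fin H (measurable_itv `[a, b[) (@bounded_set_itvco a b).
  by rewrite set_itv_ge ?bnd_simp -?leNgt// !measure0 subrr.
have [u0|u0] := leP 0 u.
  have v0 := le_trans u0 uv.
  by rewrite (emp v 0)// (emp u 0)// (add 0 u v)//; ring.
have [v0|v0] := leP 0 v.
  by rewrite (emp v 0 v0) (emp 0 u (ltW u0)) (add u 0 v (ltW u0) v0); ring.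
by rewrite (emp 0 v (ltW v0)) (emp 0 u (ltW u0)) (add u v 0 uv (ltW v0)); ring.
Qed.

(** The dominating measure is the total variation of the drift plus the point
    masses |a i| at xs i. *)
Lemma GBV_control (beta : R) (g : R -> R) : GBV_exp_with beta g ->
  exists nu : meas, (\int[nu]_y (expR (- (beta * `|y|)))%:E < +oo)%E /\
    forall a b u v : R, u \in `[a, b[ -> v \in `[a, b[ ->
      (`|g u - g v|%:E <= nu `[a, b[%classic)%E.
Proof.
move=> [c [mu [a [xs [[_ xsI gE] [mup [mun [[_ H] fin]]]]]]]].
pose nu : meas := measure_add (measure_add mup mun) (jump_measure a xs).
have mexp : measurable_fun [set: measurableTypeR R] (fun y : R => (expR (- (beta * `|y|)))%:E).
  apply/measurable_EFinP; apply: measurableT_comp => //; apply: measurableT_comp => //.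
  by apply: measurable_funM => //; exact: measurableT_comp.
exists nu; split.
  rewrite ge0_integral_measure_add//.
  rewrite [X in (_ + X)%E](_ : _ = \sum_(0 <= i <oo) (`|a i| * expR (- (beta * `|xs i|)))%:E)%E//.
  rewrite ge0_integral_measure_series//.
  apply: eq_eseriesr => i _.
  rewrite ge0_integral_mscale//.
  by rewrite integral_dirac// diracT mul1e -EFinM.
move=> p q u v up vp.
wlog uv : u v up vp / u <= v => [W|].
  by have [uv|/ltW vu] := leP u v; [exact: W|rewrite distrC; exact: W].
have [->|uv'] := eqVneq u v; first by rewrite subrr normr0.
have gJ x : g x = c + mu `[0, x[%classic - mu `[x, 0[%classic + jump_part a xs x by exact: gE.
have inc := drift_increment H uv.
have [pf nf mE] := diff_on_bounded_fin H (measurable_itv `[u, v[) (@bounded_set_itvco u v).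
have bnd : `|g u - g v| <= fine (mup `[u, v[%classic) + fine (mun `[u, v[%classic)
    + (`|jump_part a xs u| + `|jump_part a xs v|).
  rewrite distrC !gJ.
  set ju := jump_part _ _ u; set jv := jump_part _ _ v.
  rewrite (_ : _ - _ = mu `[u, v[%classic + (jv - ju)); last by rewrite -inc; ring.
  rewrite (le_trans (ler_normD _ _))// lerD//.
    by rewrite mE (le_trans (ler_normB _ _))// !ger0_norm ?fine_ge0.
  by rewrite (addrC `|ju|) ler_normB.
apply: (@le_trans _ _ ((fine (mup `[u, v[%classic) + fine (mun `[u, v[%classic)
    + (`|jump_part a xs u| + `|jump_part a xs v|))%:E)); first by rewrite lee_fin.
have nuE A : nu A = (mup A + mun A + jump_measure a xs A)%E.
  by rewrite [LHS]measure_addE [X in (X + _)%E]measure_addE.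
rewrite !EFinD !fineK// nuE.
have sub : `[u, v[%classic `<=` `[p, q[%classic.
  move=> y /=; move: up vp; rewrite !in_itv/= => /andP[pu _] /andP[_ vq] /andP[uy yv].
  by rewrite (le_trans pu uy) (lt_trans yv vq).
apply: leeD; first by apply: leeD; apply: le_measure; rewrite ?inE//.
apply: (@le_trans _ _ (jump_measure a xs [set u] + jump_measure a xs [set v])%E).
  by apply: leeD; exact: jump_part_le.
rewrite -measureU//; last first.
  by apply/seteqP; split => // y /= [-> e]; move/eqP: uv'; rewrite e.
by apply: le_measure; rewrite ?inE//; [exact: measurableU|move=> y /= [->|->]].
Qed.

End GBV.

(** * Exponential moments and weights *)

Section rates.
Context (R : realType).
Notation meas := {measure set (measurableTypeR R) -> \bar R}.
Implicit Types (beta b B h sigma x : R) (m : nat).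

Lemma expR_le_of_le_sqr B : expR B <= expR 1 * expR (B ^+ 2 / 2).
Proof. by rewrite -expRD ler_expR; have := sqr_ge0 (B - 1); rewrite !expr2; lra. Qed.

(** Complete the square in the Gaussian bound on the probabilities. *)
Lemma walk_pmf_expR_le m B (z : int) : (0 < m)%N ->
  walk_pmf R m z * expR (B * `|z%:~R|) <= expR (B ^+ 2 * m%:R / 2) / Num.sqrt m%:R.
Proof.
move=> m0; have m1 : 0 < m%:R :> R by rewrite ltr0n.
apply: (@le_trans _ _ ((Num.sqrt m%:R)^-1 * expR (- (z%:~R ^+ 2 / (2 * m%:R))) * expR (B * `|z%:~R|))).
  by rewrite ler_wpM2r ?expR_ge0//; exact: walk_pmf_le_gauss.
rewrite -mulrA mulrC ler_wpM2r ?invr_ge0 ?sqrtr_ge0// -expRD ler_expR.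
rewrite -[z%:~R ^+ 2]real_normK ?num_real//; set w := `|_|.
have : 0 <= (w - B * m%:R) ^+ 2 / (2 * m%:R).
  by rewrite divr_ge0 ?sqr_ge0// mulr_ge0// ltW.
suff -> : (w - B * m%:R) ^+ 2 / (2 * m%:R) = w ^+ 2 / (2 * m%:R) - B * w + B ^+ 2 * m%:R / 2 by lra.
by field; rewrite gt_eqF.
Qed.

(** Half of the Gaussian exponent absorbs the exponential; the remaining sum
    over the lattice is bounded by comparison with a Gaussian integral. *)
Lemma walk_mean_expR_le : exists2 C : R, 0 < C & forall m B, (0 < m)%N ->
  walk_mean m (fun z => expR (B * `|z%:~R|)) <= C * expR (B ^+ 2 * m%:R).
Proof.
exists (expR 3 * Num.sqrt (pi * 8)) => [|m B m0].
  by rewrite mulr_gt0 ?expR_gt0// sqrtr_gt0 mulr_gt0 ?pi_gt0.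
have m1 : 1 <= m%:R :> R by rewrite ler1n.
have mR0 : 0 < m%:R :> R by lra.
have s0 : 0 < Num.sqrt m%:R :> R by rewrite sqrtr_gt0.
pose F (z : int) : R := expR (B ^+ 2 * m%:R) / Num.sqrt m%:R * expR (- (z%:~R ^+ 2 / (4 * m%:R))).
have F0 z : 0 <= F z by rewrite mulr_ge0 ?divr_ge0 ?expR_ge0 ?sqrtr_ge0.
have le1 : walk_mean m (fun z => expR (B * `|z%:~R|)) <= \sum_(i < (2 * m).+1) F (i%:Z - m%:Z).
  apply: ler_sum => i _; set z := (i%:Z - m%:Z).
  apply: (@le_trans _ _ ((Num.sqrt m%:R)^-1 * expR (- (z%:~R ^+ 2 / (2 * m%:R))) * expR (B * `|z%:~R|))).
    by rewrite ler_wpM2r ?expR_ge0//; exact: walk_pmf_le_gauss.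
  have := expR_gauss_le B z%:~R mR0; rewrite /F.
  set e1 := expR (B * _); set e2 := expR (- _); set e3 := expR (B ^+ 2 * _); set e4 := expR _ => e.
  rewrite (_ : _ * e2 * e1 = (Num.sqrt m%:R)^-1 * (e1 * e2)); last by ring.
  rewrite (_ : e3 / _ * e4 = (Num.sqrt m%:R)^-1 * (e3 * e4)); last by ring.
  by rewrite ler_wpM2l ?invr_ge0 ?sqrtr_ge0.
apply: (le_trans le1).
pose G (w : R) : R := expR (B ^+ 2 * m%:R) / Num.sqrt m%:R * (expR 3 * expR (- (w ^+ 2 / (8 * m%:R)))).
have mG : measurable_fun [set: R] G.
  by apply: measurable_funM => //; apply: measurable_funM => //; exact: measurable_gauss.
have FG w : lattice_step 1 m F w <= G w.
  rewrite lattice_stepE// divr1; case: ifP => _; last first.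
    by rewrite /G !mulr_ge0 ?expR_ge0 ?invr_ge0 ?sqrtr_ge0.
  rewrite /F /G ler_wpM2l ?divr_ge0 ?expR_ge0 ?sqrtr_ge0// -expRD ler_expR.
  have := dist_floor_norm w; rewrite natr_absz intr_norm.
  rewrite -[_%:~R ^+ 2]real_normK ?num_real// -[w ^+ 2]real_normK ?num_real//.
  set p := `|_%:~R|; set q := `|w| => pq.
  (* the integer part is within 1 of w, so half of q ^ 2 is kept *)
  have q2 : q ^+ 2 <= 2 * p ^+ 2 + 2.
    have : (p - q) ^+ 2 <= 1 by rewrite -real_normK ?num_real ?expr_le1.
    have := sqr_ge0 (2 * p - q); rewrite !expr2; nra.
  have -> : q ^+ 2 / (8 * m%:R) = (q ^+ 2 / 2) / (4 * m%:R) by field; lra.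
  have : (q ^+ 2 / 2) / (4 * m%:R) <= (p ^+ 2 + 1) / (4 * m%:R).
    by rewrite ler_wpM2r ?invr_ge0//; lra.
  rewrite (mulrDl _ 1) => h.
  have : 1 / (4 * m%:R) <= 1 :> R by rewrite ler_pdivrMr; lra.
  lra.
have m40 : 0 < 8 * m%:R :> R by lra.
have : (\int[@lebesgue_measure R]_w (lattice_step 1 m F w)%:E <= \int[@lebesgue_measure R]_w (G w)%:E)%E.
  apply: ge0_le_integral => //.
  - move=> w _; rewrite lee_fin lattice_stepE//; by case: ifP.
  - by apply/measurable_EFinP; exact: measurable_lattice_step.
  - by apply/measurable_EFinP.
  - by move=> w _; rewrite lee_fin.
rewrite integral_lattice_step// mul1r /G.
under eq_integral do rewrite mulrA EFinM.
rewrite integralZl//; last exact: integrable_gauss.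
rewrite integral_gauss// -EFinM lee_fin => /le_trans; apply.
rewrite mulrA sqrtrM; last by rewrite mulr_ge0 ?pi_ge0.
by rewrite le_eqVlt; apply/orP; left; apply/eqP; field; rewrite gt_eqF.
Qed.

Lemma weighted_itv_le (nu : meas) beta (p q B : R) : 0 <= beta ->
  (forall y, y \in `[p, q[ -> `|y| <= B) ->
  (nu `[p, q[%classic <=
    (expR (beta * B))%:E * \int[nu]_(y in `[p, q[%classic) (expR (- (beta * `|y|)))%:E)%E.
Proof.
move=> b0 yB; have mI : measurable (`[p, q[%classic : set (measurableTypeR R)) by exact: measurable_itv.
have mexp : measurable_fun [set: measurableTypeR R] (fun y : R => (expR (- (beta * `|y|)))%:E).
  apply/measurable_EFinP; apply: measurableT_comp => //; apply: measurableT_comp => //.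
  by apply: measurable_funM => //; exact: measurableT_comp.
have mexpI : measurable_fun (`[p, q[%classic : set (measurableTypeR R)) (fun y : R => (expR (- (beta * `|y|)))%:E).
  exact: measurable_funTS.
rewrite -ge0_integralZl//.
rewrite -[leLHS]mul1e -integral_cst//; apply: ge0_le_integral => //.
- exact: emeasurable_funM.
move=> y /= yI; rewrite -EFinM lee_fin -expRD -expR0 ler_expR.
by rewrite subr_ge0 ler_wpM2l// yB.
Qed.

End rates.

(** * Rate for functions of weighted bounded variation *)

Section GBV_rate.
Context (R : realType).
Notation meas := {measure set (measurableTypeR R) -> \bar R}.
Implicit Types (beta b B h sigma x : R) (m : nat).

Lemma GBV_growth (nu : meas) beta (g : R -> R) : 0 <= beta ->
  (\int[nu]_y (expR (- (beta * `|y|)))%:E < +oo)%E ->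
  (forall a b u v : R, u \in `[a, b[ -> v \in `[a, b[ ->
      (`|g u - g v|%:E <= nu `[a, b[%classic)%E) ->
  exists2 K : R, 0 <= K & forall y, `|g y| <= K * expR (beta * `|y|).
Proof.
move=> b0 fin ctl; set I := (\int[nu]_y _)%E in fin.
have I0 : (0 <= I)%E by apply: integral_ge0 => y _; rewrite lee_fin expR_ge0.
have If : I \is a fin_num by rewrite ge0_fin_numE.
exists (`|g 0| + expR beta * fine I) => [|y].
  by rewrite addr_ge0// mulr_ge0 ?expR_ge0 ?fine_ge0.
have y0 := normr_ge0 y.
have yI : y \in `[- `|y|, `|y| + 1[.
  by rewrite in_itv/=; have := ler_norm y; have := lerNnormlW (lexx `|y|); lra.
have zI : 0 \in `[- `|y|, `|y| + 1[ by rewrite in_itv/=; lra.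
have yB z : z \in `[- `|y|, `|y| + 1[ -> `|z| <= `|y| + 1.
  by rewrite in_itv/= ler_norml; lra.
have : `|g y - g 0| <= expR (beta * (`|y| + 1)) * fine I.
  rewrite -lee_fin EFinM fineK//.
  apply: (le_trans (ctl _ _ _ _ yI zI)); apply: (le_trans (weighted_itv_le nu b0 yB)).
  apply: lee_pmul => //.
    by apply: integral_ge0 => z _; rewrite lee_fin expR_ge0.
  apply: ge0_subset_integral => //.
  apply/measurable_EFinP; apply: measurableT_comp => //; apply: measurableT_comp => //.
    by apply: measurable_funM => //; exact: measurableT_comp.
rewrite mulrDr mulr1 expRD => h.
have g0 : `|g 0| <= `|g 0| * expR (beta * `|y|).
  by rewrite ler_peMr// -expR0 ler_expR mulr_ge0.
have := ler_normD (g y - g 0) (g 0); rewrite subrK => /le_trans; apply.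
rewrite mulrDl addrC; apply: lerD => //.
by rewrite mulrAC (mulrC (expR beta)).
Qed.

Lemma sum_cells_integral_le (nu : meas) (f : R -> \bar R) m h sigma x :
  0 < h -> 0 < sigma -> measurable_fun [set: measurableTypeR R] f -> (forall y, 0 <= f y)%E ->
  (\sum_(i < (2 * m).+1) \int[nu]_(y in `[(x + sigma * ((i%:Z - m%:Z)%:~R * h))%R,
     (x + sigma * ((i%:Z - m%:Z + 1)%:~R * h))%R[%classic) f y <= \int[nu]_y f y)%E.
Proof.
move=> h0 s0 mf f0.
pose I (i : 'I_(2 * m).+1) : set (measurableTypeR R) := `[(x + sigma * ((i%:Z - m%:Z)%:~R * h))%R,
     (x + sigma * ((i%:Z - m%:Z + 1)%:~R * h))%R[%classic.
have mI i : measurable (I i) by exact: measurable_itv.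
have inI i y : I i y -> cell h (i%:Z - m%:Z) ((y - x) / sigma).
  rewrite /I /cell /= !in_itv/= => /andP[h1 h2]; apply/andP; split.
    by rewrite ler_pdivlMr// mulrC; lra.
  by rewrite ltr_pdivrMr// mulrC; lra.
have tI : trivIset [set` index_enum 'I_(2 * m).+1] I.
  move=> i j _ _ [y [/inI/(in_cell _ _ h0) yi /inI/(in_cell _ _ h0) yj]].
  by apply/val_inj; move: yi; rewrite yj /= => yi; lia.
have := @ge0_integral_bigsetU _ _ _ nu _ I f (index_enum 'I_(2 * m).+1) mI
  (index_enum_uniq _) tI (measurable_funTS mf) (fun y _ => f0 y).
move=> /= <-; apply: ge0_subset_integral => //.
exact: bigsetU_measurable.
Qed.

Lemma cell_image_bound h sigma x (z : int) (y : R) : 0 < h -> 0 < sigma ->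
  y \in `[x + sigma * (z%:~R * h), x + sigma * ((z + 1)%:~R * h)[ ->
  `|y| <= `|x| + sigma * h * (`|z%:~R| + 1).
Proof.
move=> h0 s0; rewrite in_itv/= intrD => /andP[y1 y2].
have sh : 0 < sigma * h by rewrite mulr_gt0.
have zn : - `|z%:~R : R| <= z%:~R <= `|z%:~R : R| by rewrite -ler_norml.
have : `|y - x| <= sigma * h * (`|z%:~R| + 1).
  move: zn => /andP[z1 z2]; rewrite ler_norml; apply/andP; split; nra.
have := ler_normD (y - x) x; rewrite subrK; lra.
Qed.

(** The oscillation on the cell z is at most the mass of its image, that is, at
    most exp(beta sup |y|) times its weighted mass.  Each probability times
    its weight is O(1 / sqrt m), up to an exponential factor in
    beta^2 sigma^2 h^2 m, and the weighted masses of the disjoint images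
    have a finite sum. *)
Lemma GBV_rate beta (g : R -> R) : 0 <= beta -> measurable_fun [set: R] g ->
  GBV_exp_with beta g -> exists2 C : R, 0 < C &
  forall m h t sigma x, (0 < m)%N -> 0 < h -> 0 < t -> 0 < sigma ->
  m%:R - 1 <= 2 * t / h ^+ 2 -> 2 * t / h ^+ 2 <= m%:R ->
  (`| (walk_mean m (fun z => g (x + sigma * (z%:~R * h))))%:E
     - \int[@lebesgue_measure R]_w (g (x + sigma * w) * normal_pdf 0 (Num.sqrt t) w)%:E | <=
   (C * expR (beta * `|x|) * expR (beta ^+ 2 * sigma ^+ 2 * (h ^+ 2 * m%:R)) / Num.sqrt m%:R)%:E)%E.
Proof.
move=> b0 mg /GBV_control[nu [fin ctl]].
have [K K0 gK] := GBV_growth b0 fin ctl.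
have [C C0 cmp] := walk_gauss_compare R.
set J := (\int[nu]_y _)%E in fin.
have J0 : (0 <= J)%E by apply: integral_ge0 => y _; rewrite lee_fin expR_ge0.
have Jf : J \is a fin_num by rewrite ge0_fin_numE.
exists (C * K + expR 1 * fine J + 1) => [|m h t sigma x m0 h0 t0 s0 V1 Vm].
  by rewrite ltr_pwDr// addr_ge0// mulr_ge0 ?expR_ge0 ?fine_ge0// ltW.
have m1 : 1 <= m%:R :> R by rewrite ler1n.
have sm : 0 < Num.sqrt m%:R :> R by rewrite sqrtr_gt0; lra.
pose I (z : int) : set R := `[x + sigma * (z%:~R * h), x + sigma * ((z + 1)%:~R * h)[%classic.
pose e (y : R) : \bar R := (expR (- (beta * `|y|)))%:E.
have me : measurable_fun [set: measurableTypeR R] e.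
  apply/measurable_EFinP; apply: measurableT_comp => //; apply: measurableT_comp => //.
  by apply: measurable_funM => //; exact: measurableT_comp.
have e0 y : (0 <= e y)%E by rewrite lee_fin expR_ge0.
have N0 z : (0 <= \int[nu]_(y in I z) e y)%E by exact: integral_ge0.
have Nf z : (\int[nu]_(y in I z) e y)%E \is a fin_num.
  rewrite ge0_fin_numE//; apply: le_lt_trans fin.
  by apply: ge0_subset_integral => //; exact: measurable_itv.
pose N z : R := fine (\int[nu]_(y in I z) e y).
have N0' z : 0 <= N z by rewrite fine_ge0.
pose osc z := expR (beta * (`|x| + sigma * h * (`|z%:~R| + 1))) * N z.
have oscP z w : cell h z w ->
    `|g (x + sigma * (z%:~R * h)) - g (x + sigma * w)| <= osc z.
  rewrite /cell /= in_itv/= => /andP[zw wz].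
  have uI : x + sigma * (z%:~R * h) \in `[x + sigma * (z%:~R * h), x + sigma * ((z + 1)%:~R * h)[.
    by rewrite in_itv/= lexx ltrD2l ltr_pM2l// ltr_pM2r// ltr_int ltrDl.
  have vI : x + sigma * w \in `[x + sigma * (z%:~R * h), x + sigma * ((z + 1)%:~R * h)[.
    by rewrite in_itv/= lerD2l ler_pM2l// ltrD2l ltr_pM2l// zw wz.
  rewrite -lee_fin (le_trans (ctl _ _ _ _ uI vI))// /osc EFinM fineK//.
  by apply: weighted_itv_le => // y yI; exact: cell_image_bound yI.
apply: (le_trans (cmp m h t g K beta sigma x osc m0 h0 t0 V1 Vm K0 b0 (ltW s0) mg gK oscP)).
rewrite lee_fin; set A := h ^+ 2 * m%:R.
set E := expR (beta ^+ 2 * sigma ^+ 2 * A); set X := expR (beta * `|x|).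
pose D := beta * (sigma * h).
have D2 : D ^+ 2 * m%:R = beta ^+ 2 * sigma ^+ 2 * A by rewrite /D /A; ring.
have oscE : walk_mean m osc <= X * expR 1 * E / Num.sqrt m%:R * fine J.
  apply: (@le_trans _ _ (X * expR 1 * E / Num.sqrt m%:R * \sum_(i < (2 * m).+1) N (i%:Z - m%:Z))).
    rewrite mulr_sumr; apply: ler_sum => i _; set z := (i%:Z - m%:Z).
    rewrite /osc mulrA; apply: ler_wpM2r => //.
    have -> : expR (beta * (`|x| + sigma * h * (`|z%:~R| + 1))) =
        X * expR D * expR (D * `|z%:~R|).
      by rewrite /X /D -!expRD; congr expR; ring.
    have sw (q e' X' D' : R) : q * (X' * D' * e') = X' * (D' * (q * e')) by ring.
    have sw' (X' a E' s : R) : X' * a * E' / s = X' * (a * (E' / s)) by ring.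
    rewrite sw sw'; apply: ler_wpM2l; first exact: expR_ge0.
    have h1 := walk_pmf_expR_le D z m0.
    have h2 := expR_le_of_le_sqr D.
    apply: (@le_trans _ _ (expR 1 * expR (D ^+ 2 / 2) * (expR (D ^+ 2 * m%:R / 2) / Num.sqrt m%:R))).
      by apply: ler_pM => //; rewrite ?expR_ge0// mulr_ge0 ?expR_ge0 ?walk_pmf_ge0.
    rewrite -mulrA ler_wpM2l ?expR_ge0// mulrA ler_wpM2r ?invr_ge0 ?sqrtr_ge0//.
    rewrite -expRD ler_expR -D2.
    have : D ^+ 2 * 1 <= D ^+ 2 * m%:R by rewrite ler_wpM2l ?sqr_ge0.
    lra.
  apply: ler_wpM2l; first by rewrite divr_ge0 ?sqrtr_ge0// !mulr_ge0 ?expR_ge0.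
  rewrite -lee_fin fineK// -sumEFin.
  under eq_bigr do rewrite fineK//.
  exact: sum_cells_integral_le.
have XE : 0 <= X * E / Num.sqrt m%:R by rewrite divr_ge0 ?sqrtr_ge0// mulr_ge0 ?expR_ge0.
apply: (le_trans (lerD (lexx _) oscE)).
rewrite (_ : C * K * X * E / Num.sqrt m%:R + X * expR 1 * E / Num.sqrt m%:R * fine J =
  (C * K + expR 1 * fine J) * (X * E / Num.sqrt m%:R)); last by ring.
rewrite (_ : (C * K + expR 1 * fine J + 1) * X * E / Num.sqrt m%:R =
  (C * K + expR 1 * fine J + 1) * (X * E / Num.sqrt m%:R)); last by ring.
by rewrite ler_wpM2r// lerDl.
Qed.

End GBV_rate.

(** * Rate for locally Hoelder functions *)

Section hoelder_rate.
Context (R : realType).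
Implicit Types (alpha b B h sigma x : R) (m : nat).

Lemma powR_le1D (a alpha : R) : 0 <= a -> 0 <= alpha -> alpha <= 1 -> a `^ alpha <= 1 + a.
Proof.
move=> a0 al0 al1; have [a1|a1] := leP a 1.
  have := @ge0_ler_powR R alpha al0 a 1; rewrite !nnegrE powR1 a0 => /(_ isT ler01 a1); lra.
have := ler1_powR (ltW a1) al1; lra.
Qed.

Lemma hoelder_expP alpha b (g : R -> R) : 0 < alpha -> 0 <= b -> hoelder_exp_with alpha b g ->
  exists2 A : R, 0 <= A & forall u v r, `|u| <= r -> `|v| <= r ->
    `|g u - g v| <= A * expR (b * r) * `|u - v| `^ alpha.
Proof.
move=> al0 b0 [A A0 H]; exists A => // u v r ur vr.
have [->|uv] := eqVneq u v.
  by rewrite subrr normr0 !mulr_ge0 ?expR_ge0 ?powR_ge0.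
have uv0 : 0 < `|u - v| by rewrite normr_gt0 subr_eq0.
have r0 : 0 < r.
  rewrite lt_neqAle (le_trans (normr_ge0 u) ur) andbT; apply/eqP => r0.
  by have := ler_normB u v; move: ur vr; rewrite -r0; lra.
have p0 : 0 < `|u - v| `^ alpha by rewrite powR_gt0.
have : ((`|g u - g v| / `|u - v| `^ alpha)%:E <= (A * expR (b * r))%:E)%E.
  apply: le_trans (H r r0); apply: ereal_sup_ubound.
  by exists u, v; split=> //; rewrite in_itv/= -ler_norml.
by rewrite lee_fin ler_pdivrMr.
Qed.

(** The power |y|^alpha is absorbed by raising the exponential rate by 1/2. *)
Lemma hoelder_growth alpha b A (g : R -> R) : 0 <= alpha -> alpha <= 1 -> 0 <= b -> 0 <= A ->
  (forall u v r, `|u| <= r -> `|v| <= r ->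
    `|g u - g v| <= A * expR (b * r) * `|u - v| `^ alpha) ->
  forall y, `|g y| <= (`|g 0| + 2 * A) * expR ((b + 2^-1) * `|y|).
Proof.
move=> al0 al1 b0 A0 H y; have y0 := normr_ge0 y.
have := H y 0 `|y| (lexx _); rewrite normr0 subr0 => /(_ y0) h.
have p : `|y| `^ alpha <= 2 * expR (2^-1 * `|y|).
  have := powR_le1D y0 al0 al1; have := expR_ge1Dx (2^-1 * `|y|); lra.
rewrite (mulrDl b) expRD.
have e1 : 1 <= expR (b * `|y|) by rewrite -expR0 ler_expR mulr_ge0.
have e2 : 1 <= expR (2^-1 * `|y|) by rewrite -[leLHS]expR0 ler_expR; lra.
have h2 : `|g y - g 0| <= A * expR (b * `|y|) * (2 * expR (2^-1 * `|y|)).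
  by apply: (le_trans h); rewrite ler_wpM2l// mulr_ge0 ?expR_ge0.
have g0 : `|g 0| <= `|g 0| * (expR (b * `|y|) * expR (2^-1 * `|y|)).
  by rewrite ler_peMr// -[leLHS]mulr1 ler_pM.
have := ler_normD (g y - g 0) (g 0); rewrite subrK => /le_trans; apply.
rewrite mulrDl; lra.
Qed.

(** Every oscillation is O((sigma h)^alpha) with an exponential weight, and the
    weights are summed by the exponential moments of the walk. *)
Lemma hoelder_rate alpha b A (g : R -> R) : 0 < alpha -> alpha <= 1 -> 0 <= b -> 0 <= A ->
  measurable_fun [set: R] g ->
  (forall u v r, `|u| <= r -> `|v| <= r ->
    `|g u - g v| <= A * expR (b * r) * `|u - v| `^ alpha) ->
  exists2 C : R, 0 < C &
  forall m h t sigma x, (0 < m)%N -> 0 < h -> 0 < t -> 0 < sigma ->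
  m%:R - 1 <= 2 * t / h ^+ 2 -> 2 * t / h ^+ 2 <= m%:R ->
  (`| (walk_mean m (fun z => g (x + sigma * (z%:~R * h))))%:E
     - \int[@lebesgue_measure R]_w (g (x + sigma * w) * normal_pdf 0 (Num.sqrt t) w)%:E | <=
   (C * expR ((b + 2^-1) * `|x|) *
    expR ((b + 2^-1) ^+ 2 * sigma ^+ 2 * (h ^+ 2 * m%:R) * (3 / 2)) *
    ((Num.sqrt m%:R)^-1 + (sigma * h) `^ alpha))%:E)%E.
Proof.
move=> al0 al1 b0 A0 mg H.
have [C C0 cmp] := walk_gauss_compare R.
have [C' C'0 mgf] := walk_mean_expR_le R.
have gK := hoelder_growth (ltW al0) al1 b0 A0 H.
set K := `|g 0| + 2 * A in gK.
have K0 : 0 <= K by rewrite addr_ge0// mulr_ge0.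
have bb : 0 <= b + 2^-1 by lra.
exists (C * K + A * expR 1 * C' + 1) => [|m h t sigma x m0 h0 t0 s0 V1 Vm].
  by rewrite ltr_pwDr// addr_ge0// !mulr_ge0 ?expR_ge0// ltW.
have m1 : 1 <= m%:R :> R by rewrite ler1n.
have sh : 0 < sigma * h by rewrite mulr_gt0.
set P := (sigma * h) `^ alpha.
have P0 : 0 <= P by exact: powR_ge0.
pose osc (z : int) := A * expR (b * (`|x| + sigma * h * (`|z%:~R| + 1))) * P.
have oscP z w : cell h z w ->
    `|g (x + sigma * (z%:~R * h)) - g (x + sigma * w)| <= osc z.
  rewrite /cell /= in_itv/= => /andP[zw wz].
  have uI : x + sigma * (z%:~R * h) \in `[x + sigma * (z%:~R * h), x + sigma * ((z + 1)%:~R * h)[.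
    by rewrite in_itv/= lexx ltrD2l ltr_pM2l// ltr_pM2r// ltr_int ltrDl.
  have vI : x + sigma * w \in `[x + sigma * (z%:~R * h), x + sigma * ((z + 1)%:~R * h)[.
    by rewrite in_itv/= lerD2l ler_pM2l// ltrD2l ltr_pM2l// zw wz.
  apply: (le_trans (H _ _ _ (cell_image_bound h0 s0 uI) (cell_image_bound h0 s0 vI))).
  rewrite /osc ler_wpM2l ?mulr_ge0 ?expR_ge0//.
  apply: ge0_ler_powR; rewrite ?nnegrE ?(ltW al0) ?(ltW sh)//.
  have -> : x + sigma * (z%:~R * h) - (x + sigma * w) = - (sigma * (w - z%:~R * h)) by ring.
  rewrite normrN normrM (gtr0_norm s0) ler_pM2l// ger0_norm ?subr_ge0//.
  by move: wz; rewrite intrD mulrDl; lra.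
apply: (le_trans (cmp m h t g K _ sigma x osc m0 h0 t0 V1 Vm K0 bb (ltW s0) mg gK oscP)).
rewrite lee_fin; set Q := h ^+ 2 * m%:R.
set X := expR ((b + 2^-1) * `|x|).
set E := expR ((b + 2^-1) ^+ 2 * sigma ^+ 2 * Q * (3 / 2)).
have Q0 : 0 <= (b + 2^-1) ^+ 2 * sigma ^+ 2 * Q by apply: mulr_ge0; apply: mulr_ge0; rewrite ?sqr_ge0.
have E1 : expR ((b + 2^-1) ^+ 2 * sigma ^+ 2 * Q) <= E by rewrite ler_expR; lra.
pose D := b * (sigma * h).
have D2 : D ^+ 2 * m%:R = b ^+ 2 * sigma ^+ 2 * Q by rewrite /D /Q; ring.
have oscE : walk_mean m osc <= A * expR 1 * C' * (X * E * P).
  have -> : walk_mean m osc = A * expR (b * `|x|) * expR D * P * walk_mean m (fun z => expR (D * `|z%:~R|)).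
    rewrite mulr_sumr; apply: eq_bigr => i _; rewrite /osc; set z := (i%:Z - m%:Z).
    have -> : expR (b * (`|x| + sigma * h * (`|z%:~R| + 1))) =
        expR (b * `|x|) * expR D * expR (D * `|z%:~R|).
      by rewrite /D -!expRD; congr expR; ring.
    ring.
  have h1 := mgf m D m0.
  have h2 := expR_le_of_le_sqr D.
  have h3 : expR (b * `|x|) <= X.
    by rewrite ler_expR ler_wpM2r//; lra.
  have h4 : expR (D ^+ 2 / 2) * expR (D ^+ 2 * m%:R) <= E.
    rewrite -expRD ler_expR -/Q.
    have : D ^+ 2 * 1 <= D ^+ 2 * m%:R by rewrite ler_wpM2l ?sqr_ge0.
    have : D ^+ 2 * m%:R <= (b + 2^-1) ^+ 2 * sigma ^+ 2 * Q.
      rewrite D2; apply: ler_wpM2r; first by apply: mulr_ge0; rewrite ?sqr_ge0.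
      apply: ler_wpM2r; first exact: sqr_ge0.
      by apply: lerXn2r; rewrite ?nnegrE//; lra.
    lra.
  apply: (@le_trans _ _ (A * X * (expR 1 * expR (D ^+ 2 / 2)) * P * (C' * expR (D ^+ 2 * m%:R)))).
    apply: ler_pM => //.
    - by rewrite !mulr_ge0 ?expR_ge0.
    - by apply: walk_mean_ge0 => z _; exact: expR_ge0.
    - apply: ler_wpM2r => //; apply: ler_pM; rewrite ?mulr_ge0 ?expR_ge0//.
      by apply: ler_wpM2l.
  rewrite (_ : _ * (C' * _) = A * expR 1 * C' * X * P * (expR (D ^+ 2 / 2) * expR (D ^+ 2 * m%:R))); last by ring.
  rewrite (_ : A * expR 1 * C' * (X * E * P) = A * expR 1 * C' * X * P * E); last by ring.
  by apply: ler_wpM2l => //; rewrite !mulr_ge0 ?expR_ge0// ltW.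
set S := (Num.sqrt m%:R)^-1.
have S0 : 0 <= S by rewrite invr_ge0 sqrtr_ge0.
have X0 : 0 <= X by exact: expR_ge0.
have E0 : 0 <= E by exact: expR_ge0.
have p1 : C * K * X * expR ((b + 2^-1) ^+ 2 * sigma ^+ 2 * Q) * S <= C * K * (X * E * S).
  rewrite (_ : C * K * (X * E * S) = C * K * X * E * S); last by ring.
  by apply: ler_wpM2r => //; apply: ler_wpM2l => //; rewrite !mulr_ge0// ltW.
apply: (le_trans (lerD p1 oscE)).
set c1 := C * K; set c2 := A * expR 1 * C'.
have c10 : 0 <= c1 by rewrite mulr_ge0// ltW.
have c20 : 0 <= c2 by rewrite !mulr_ge0 ?expR_ge0// ltW.
have XS : 0 <= X * E * S by rewrite !mulr_ge0.
have XP : 0 <= X * E * P by rewrite !mulr_ge0.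
rewrite (_ : (c1 + c2 + 1) * X * E * (S + P) = (c1 + c2 + 1) * (X * E * S) + (c1 + c2 + 1) * (X * E * P)); last by ring.
by apply: lerD; apply: ler_wpM2r => //; lra.
Qed.

End hoelder_rate.

(** * From lattice parameters to the time grid *)

Section assembly.
Context (R : realType).

Lemma mesh_identities (S t : R) (n m : nat) : 0 < S -> (0 < n)%N -> (2 * m <= n)%N ->
  let h := 2 * Num.sqrt (S / n%:R) in
  [/\ 0 < h, h ^+ 2 = 4 * S / n%:R, 2 * (S - t) / h ^+ 2 = (S - t) / (2 * S / n%:R) &
      h ^+ 2 * m%:R <= 2 * S].
Proof.
move=> S0 n0 mn h.
have nR : 0 < n%:R :> R by rewrite ltr0n.
have Sn : 0 < S / n%:R by rewrite divr_gt0.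
have h2 : h ^+ 2 = 4 * S / n%:R.
  by rewrite /h exprMn sqr_sqrtr ?(ltW Sn)// -natrX mulrA.
split=> //.
- by rewrite mulr_gt0// sqrtr_gt0.
- by rewrite h2; field; rewrite !gt_eqF.
- rewrite h2 mulrAC ler_pdivrMr//.
  have : (2 * m)%:R <= n%:R :> R by rewrite ler_nat.
  rewrite natrM => mn'; nra.
Qed.

(** The bound m >= V turns the rate 1 / sqrt m into
    sqrt (2 S) / sqrt (n (S - t)). *)
Lemma value_fun_GBV (beta : R) (g : R -> R) : 0 <= beta -> measurable_fun [set: R] g ->
  GBV_exp_with beta g -> exists2 C : R, 0 < C &
  forall (S sigma : R) (n : nat), 0 < S -> 0 < sigma -> (0 < n)%N -> ~~ odd n ->
  forall d (Omega : measurableType d) (P : probability Omega R)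
    (W : R -> {RV P >-> R}) (xi : nat -> {RV P >-> R}),
  standard_brownian_motion W -> iid_rademacher xi ->
  forall t x, 0 <= t -> t < S ->
  (`| value_fun P g sigma S (scaled_walk xi S n) t x
      - value_fun P g sigma S (fun t w => W t w) t x | <=
    (C * Num.sqrt S * expR (3 * beta ^+ 2 * sigma ^+ 2 * S) / Num.sqrt (n%:R * (S - t))
     * expR (beta * `|x|))%:E)%E.
Proof.
move=> b0 mg gGBV; have [C C0 rate] := GBV_rate b0 mg gGBV.
have [nu [fin ctl]] := GBV_control gGBV.
have [K K0 gK] := GBV_growth b0 fin ctl.
exists (C * Num.sqrt 2) => [|S sigma n S0 s0 n0 nodd d Omega P W xi hW hxi t x t0 tS].
  by rewrite mulr_gt0// sqrtr_gt0.
have [m0 mn V1 Vm] := walk_steps_bounds S0 t0 tS n0 nodd.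
set m := `|_|%N in m0 mn V1 Vm.
have [h0 h2 hV hm] := mesh_identities t S0 n0 mn.
rewrite (value_fun_walk hxi)// (value_fun_brownian _ hW tS mg K0 b0 (ltW s0) gK) -/m.
set h := 2 * _ in h0 h2 hV hm *.
have th0 : 0 < S - t by lra.
rewrite -hV in V1 Vm.
apply: (le_trans (rate m h (S - t) sigma x m0 h0 th0 s0 (ltW V1) Vm)).
rewrite lee_fin.
have nR : 0 < n%:R :> R by rewrite ltr0n.
have mR : 0 < m%:R :> R by rewrite ltr0n.
have nt0 : 0 < Num.sqrt (n%:R * (S - t)) by rewrite sqrtr_gt0 mulr_gt0.
have sm0 : 0 < Num.sqrt m%:R :> R by rewrite sqrtr_gt0.
have inv : (Num.sqrt m%:R)^-1 <= Num.sqrt 2 * Num.sqrt S / Num.sqrt (n%:R * (S - t)).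
  rewrite ler_pdivlMr// mulrC ler_pdivrMr//.
  have -> : Num.sqrt 2 * Num.sqrt S * Num.sqrt m%:R = Num.sqrt (2 * S * m%:R).
    by rewrite (sqrtrM m%:R) ?(sqrtrM S)// mulr_ge0// ltW.
  apply: ler_wsqrtr.
  move: Vm; rewrite h2 (_ : 2 * (S - t) / (4 * S / n%:R) = n%:R * (S - t) / (2 * S)); last first.
    by field; rewrite !gt_eqF.
  by rewrite ler_pdivrMr ?mulr_gt0// (mulrC m%:R).
have ex : expR (beta ^+ 2 * sigma ^+ 2 * (h ^+ 2 * m%:R)) <= expR (3 * beta ^+ 2 * sigma ^+ 2 * S).
  rewrite ler_expR.
  set q := beta ^+ 2 * sigma ^+ 2.
  have q0 : 0 <= q by apply: mulr_ge0; exact: sqr_ge0.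
  have qA : q * (h ^+ 2 * m%:R) <= q * (2 * S) by exact: ler_wpM2l.
  have qS : 0 <= q * S by apply: mulr_ge0 => //; exact: ltW.
  rewrite (_ : 3 * beta ^+ 2 * sigma ^+ 2 * S = 3 * (q * S)); last by rewrite /q; ring.
  have q2 : q * (2 * S) = 2 * (q * S) by ring.
  by apply: (le_trans qA); rewrite q2; clear -qS; lra.
set X := expR (beta * `|x|).
apply: (@le_trans _ _ (C * X * expR (3 * beta ^+ 2 * sigma ^+ 2 * S) *
    (Num.sqrt 2 * Num.sqrt S / Num.sqrt (n%:R * (S - t))))).
  have CX : 0 <= C * X by rewrite mulr_ge0 ?expR_ge0 ?(ltW C0).
  apply: ler_pM => //; first by rewrite mulr_ge0 ?expR_ge0.
  exact: ler_wpM2l.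
by rewrite le_eqVlt; apply/orP; left; apply/eqP; ring.
Qed.

(** The constant in the Hoelder estimate has to serve all admissible exponents
    beta at once, although the seminorm bound may degenerate as beta decreases
    to its infimum.  The slack between beta and beta + 1 in the conclusion
    allows one fixed exponent b to be used, at most beta + 1/2 for every
    admissible beta. *)
Lemma hoelder_exponent (alpha : R) (g : R -> R) : hoelder_exp alpha g ->
  exists b : R, [/\ 0 <= b, hoelder_exp_with alpha b g &
    forall beta : R, 0 <= beta -> hoelder_exp_with alpha beta g -> b <= beta + 2^-1].
Proof.
move=> [b0 b00 hb0]; pose B := [set b : R | 0 <= b /\ hoelder_exp_with alpha b g].
have hB : has_inf B by split; [exists b0|exists 0 => b []].
have [|b [bge hb] binf] := @inf_adherent _ B 2^-1 _ hB; first by rewrite invr_gt0.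
exists b; split=> // beta be0 hbe.
have : inf B <= beta by apply: ge_inf; [exact: hB.2|split].
lra.
Qed.

(** On the grid interval of index k the walk makes m = n / 2 - k pairs of steps,
    so n (S - grid S n k) = 2 m S; both 1 / sqrt m and (sigma h)^alpha are
    compared with the power alpha / 2 of the inverse of this quantity. *)
Lemma value_fun_hoelder (alpha : R) (g : R -> R) : 0 < alpha -> alpha <= 1 ->
  measurable_fun [set: R] g -> hoelder_exp alpha g ->
  exists2 C : R, 0 < C & forall beta : R, 0 <= beta -> hoelder_exp_with alpha beta g ->
  forall (S sigma : R) (n : nat), 0 < S -> 0 < sigma -> (0 < n)%N -> ~~ odd n ->
  forall d (Omega : measurableType d) (P : probability Omega R)
    (W : R -> {RV P >-> R}) (xi : nat -> {RV P >-> R}),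
  standard_brownian_motion W -> iid_rademacher xi ->
  forall t x k, (k < n./2)%N -> grid S n k <= t -> t < grid S n k.+1 ->
  (`| value_fun P g sigma S (scaled_walk xi S n) t x
      - value_fun P g sigma S (fun t w => W t w) t x | <=
    ((1 + S) * (2 + sigma) * C * expR (4 * (beta + 1) ^+ 2 * sigma ^+ 2 * S)
     / (n%:R `^ (alpha / 2) * (S - grid S n k) `^ (alpha / 2))
     * expR ((beta + 1) * `|x|))%:E)%E.
Proof.
move=> al0 al1 mg hg.
have [b [b0 hb bbeta]] := hoelder_exponent hg.
have [A A0 H] := hoelder_expP al0 b0 hb.
have [C C0 rate] := hoelder_rate al0 al1 b0 A0 mg H.
have gK := hoelder_growth (ltW al0) al1 b0 A0 H.
have K0 : 0 <= `|g 0| + 2 * A by rewrite addr_ge0// mulr_ge0.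
exists (5 * C) => [|beta be0 /(bbeta _ be0) bb S sigma n S0 s0 n0 nodd d Omega P W xi hW hxi t x k kn kt tk].
  by rewrite mulr_gt0.
have nR : 0 < n%:R :> R by rewrite ltr0n.
have nE : n%:R = 2 * (n./2)%:R :> R by rewrite -natrM mul2n even_halfK.
have t0 : 0 <= t by apply: le_trans kt; rewrite /grid !mulr_ge0 ?invr_ge0// ltW.
have tS : t < S.
  apply: (lt_le_trans tk); rewrite /grid ler_pdivrMr// mulrC ler_wpM2l ?(ltW S0)//.
  by rewrite nE ler_wpM2l// ler_nat.
have [m0 mn V1 Vm] := walk_steps_bounds S0 t0 tS n0 nodd.
set m := `|_|%N in m0 mn V1 Vm.
have VE : (S - t) / (2 * S / n%:R) = n%:R * (S - t) / (2 * S).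
  by field; rewrite !gt_eqF.
have mE : m = (n./2 - k)%N.
  have v1 : (n./2)%:R - k%:R - 1 < (S - t) / (2 * S / n%:R).
    rewrite VE ltr_pdivlMr ?mulr_gt0//.
    move: tk; rewrite /grid ltr_pdivlMr// -natr1 nE; nra.
  have v2 : (S - t) / (2 * S / n%:R) <= (n./2)%:R - k%:R.
    rewrite VE ler_pdivrMr ?mulr_gt0//.
    move: kt; rewrite /grid ler_pdivrMr// nE; nra.
  have l1 : (n./2)%:R < m%:R + k%:R + 1 :> R by lra.
  have l2 : m%:R + k%:R < (n./2)%:R + 1 :> R by lra.
  rewrite -natrD natr1 ltr_nat in l1; rewrite -natrD natr1 ltr_nat in l2.
  have aux (p q r : nat) : (p < (q + r).+1)%N -> (q + r < p.+1)%N -> q = (p - r)%N.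
    by clear; lia.
  exact: aux l1 l2.
have SgE : n%:R * (S - grid S n k) = 2 * m%:R * S.
  rewrite /grid mE natrB ?(ltnW kn)//.
  rewrite mulrBr (mulrC n%:R (_ / _)) divfK ?gt_eqF// nE; ring.
have [h0 h2 hV hm] := mesh_identities t S0 n0 mn.
have gb0 : 0 <= b + 2^-1 by lra.
rewrite (value_fun_walk hxi)// (value_fun_brownian _ hW tS mg K0 gb0 (ltW s0) gK) -/m.
set h := 2 * _ in h0 h2 hV hm *.
have th0 : 0 < S - t by lra.
rewrite -hV in V1 Vm.
apply: (le_trans (rate m h (S - t) sigma x m0 h0 th0 s0 (ltW V1) Vm)).
rewrite lee_fin.
have m1 : 1 <= m%:R :> R by rewrite ler1n.
have Sg0 : 0 <= S - grid S n k.
  by rewrite -(pmulr_rge0 _ nR) SgE !mulr_ge0// ltW.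
rewrite -(powRM _ (ltW nR) Sg0) SgE.
set D := (2 * m%:R * S) `^ (alpha / 2).
have mS0 : 0 < 2 * m%:R * S by rewrite !mulr_gt0//; lra.
have D0 : 0 < D by rewrite powR_gt0.
have a20 : 0 <= alpha / 2 by lra.
have a21 : alpha / 2 <= 1 by lra.
have sm0 : 0 < Num.sqrt m%:R :> R by rewrite sqrtr_gt0; lra.
have r1 : (Num.sqrt m%:R)^-1 <= (1 + S) * (2 + sigma) / D.
  rewrite ler_pdivlMr// mulrC ler_pdivrMr//.
  have -> : D = (2 * S) `^ (alpha / 2) * m%:R `^ (alpha / 2).
    by rewrite /D mulrAC; apply: powRM => //; clear -S0; lra.
  apply: ler_pM; rewrite ?powR_ge0//.
    have := @powR_le1D R (2 * S) (alpha / 2); rewrite mulr_ge0 ?(ltW S0)// => /(_ isT a20 a21).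
    nra.
  by rewrite -powR12_sqrt//; apply: ler_powR => //; lra.
have r2 : (sigma * h) `^ alpha <= 4 * ((1 + S) * (2 + sigma)) / D.
  rewrite ler_pdivlMr//.
  have -> : (sigma * h) `^ alpha = ((sigma * h) ^+ 2) `^ (alpha / 2).
    rewrite -powR_mulrn ?mulr_ge0 ?(ltW s0) ?(ltW h0)// -powRrM; congr (_ `^ _).
    by field.
  rewrite -powRM ?sqr_ge0 ?(ltW mS0)//.
  apply: (@le_trans _ _ (((2 * sigma * S) ^+ 2) `^ (alpha / 2))).
    apply: ge0_ler_powR => //.
    - by rewrite nnegrE; apply: mulr_ge0; [exact: sqr_ge0|exact: ltW].
    - by rewrite nnegrE sqr_ge0.
    have -> : (sigma * h) ^+ 2 * (2 * m%:R * S) = 2 * S * sigma ^+ 2 * (h ^+ 2 * m%:R) by ring.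
    have -> : (2 * sigma * S) ^+ 2 = 2 * S * sigma ^+ 2 * (2 * S) by ring.
    apply: ler_wpM2l => //; apply: mulr_ge0; last exact: sqr_ge0.
    by rewrite mulr_ge0// ltW.
  have sS0 : 0 <= 2 * sigma * S by rewrite !mulr_ge0 ?(ltW s0) ?(ltW S0).
  rewrite -powR_mulrn// -powRrM (_ : 2%:R * (alpha / 2) = alpha); last by field.
  rewrite powRM ?mulr_ge0 ?(ltW s0) ?(ltW S0)// powRM ?(ltW s0)//.
  have q1 := @powR_le1D R 2 alpha (ler0n _ 2) (ltW al0) al1.
  have q2 := @powR_le1D R sigma alpha (ltW s0) (ltW al0) al1.
  have q3 := @powR_le1D R S alpha (ltW S0) (ltW al0) al1.
  have p1 := powR_ge0 2 alpha. have p2 := powR_ge0 sigma alpha. have p3 := powR_ge0 S alpha.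
  rewrite (_ : 4 * _ = 4 * (2 + sigma) * (1 + S)); last by ring.
  apply: ler_pM => //; first by rewrite mulr_ge0.
  by apply: ler_pM => //; lra.
have X1 : expR ((b + 2^-1) * `|x|) <= expR ((beta + 1) * `|x|).
  by rewrite ler_expR ler_wpM2r//; lra.
have E1 : expR ((b + 2^-1) ^+ 2 * sigma ^+ 2 * (h ^+ 2 * m%:R) * (3 / 2)) <=
   expR (4 * (beta + 1) ^+ 2 * sigma ^+ 2 * S).
  rewrite ler_expR.
  have q1 : (b + 2^-1) ^+ 2 <= (beta + 1) ^+ 2 by apply: lerXn2r; rewrite ?nnegrE; move: bb b0 be0; clear; lra.
  set c := (beta + 1) ^+ 2 * sigma ^+ 2.
  have c0 : 0 <= c by apply: mulr_ge0; exact: sqr_ge0.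
  have q2 : (b + 2^-1) ^+ 2 * sigma ^+ 2 <= c by apply: ler_wpM2r => //; exact: sqr_ge0.
  have q3 : (b + 2^-1) ^+ 2 * sigma ^+ 2 * (h ^+ 2 * m%:R) <= c * (2 * S).
    apply: ler_pM => //; first by apply: mulr_ge0; exact: sqr_ge0.
    by apply: mulr_ge0 => //; exact: sqr_ge0.
  have q4 : 0 <= c * S by apply: mulr_ge0 => //; exact: ltW.
  rewrite (_ : 4 * (beta + 1) ^+ 2 * sigma ^+ 2 * S = 4 * (c * S)); last by rewrite /c; ring.
  have q5 : c * (2 * S) = 2 * (c * S) by ring.
  move: q3 q4; rewrite q5; move: (_ * (h ^+ 2 * _)) (c * S) => y z; clear; lra.
set X := expR ((beta + 1) * `|x|) in X1 *; set E := expR (4 * _ * _ * _) in E1 *.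
set Z := (1 + S) * (2 + sigma) in r1 r2 *.
have X0 : 0 <= X by exact: expR_ge0.
have E0 : 0 <= E by exact: expR_ge0.
apply: (@le_trans _ _ (C * X * E * (Z / D + 4 * Z / D))).
  apply: ler_pM.
  - by rewrite !mulr_ge0 ?expR_ge0// ltW.
  - by rewrite addr_ge0 ?powR_ge0// invr_ge0 ltW.
  - apply: ler_pM; rewrite ?mulr_ge0 ?expR_ge0 ?(ltW C0)//.
    by apply: ler_wpM2l => //; exact: ltW.
  - exact: lerD.
by rewrite le_eqVlt; apply/orP; left; apply/eqP; ring.
Qed.

End assembly.

Unset Implicit Arguments.
Set Strict Implicit.
Set Printing Implicit Defensive.

Theorem theorem2p6 (R : realType) (g : R -> R)
    (mg : measurable_fun [set: R] g) (eg : exp_bounded g) :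
  (* (A) *)
  (GBV_exp g -> forall beta : R, 0 <= beta -> GBV_exp_with beta g ->
    exists C : R, 0 < C /\
      forall (T sigma : R) (n : nat), 0 < T -> 0 < sigma -> (0 < n)%N -> ~~ odd n ->
      forall (d : measure_display) (Omega : measurableType d)
        (P : probability Omega R)
        (W : R -> {RV P >-> R}) (xi : nat -> {RV P >-> R}),
      standard_brownian_motion W -> iid_rademacher xi ->
      let u := value_fun P g sigma T (fun t w => W t w) in
      let un := value_fun P g sigma T (scaled_walk xi T n) in
      let Cbst := C * Num.sqrt T * expR (3 * beta ^+ 2 * sigma ^+ 2 * T) in
      (* (i) *)
      (forall t x : R, 0 <= t -> t < T ->
        (forall k : nat, (k < n./2)%N -> t != grid T n k) ->
        (`| un t x - u t x | <=
          (Cbst / Num.sqrt (n%:R * (T - t)) * expR (beta * `|x|))%:E)%E) /\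
      (* (ii) *)
      (forall (k : nat) (x : R), (k < n./2)%N ->
        (`| un (grid T n k) x - u (grid T n k) x | <=
          (Cbst / Num.sqrt (n%:R * (T - grid T n k)) * expR (beta * `|x|))%:E)%E))
  /\
  (* (B) *)
  (forall alpha : R, 0 < alpha -> alpha <= 1 -> hoelder_exp alpha g ->
    exists C : R, 0 < C /\
      forall beta : R, 0 <= beta -> hoelder_exp_with alpha beta g ->
      forall (T sigma : R) (n : nat), 0 < T -> 0 < sigma -> (0 < n)%N -> ~~ odd n ->
      forall (d : measure_display) (Omega : measurableType d)
        (P : probability Omega R)
        (W : R -> {RV P >-> R}) (xi : nat -> {RV P >-> R}),
      standard_brownian_motion W -> iid_rademacher xi ->
      let u := value_fun P g sigma T (fun t w => W t w) in
      let un := value_fun P g sigma T (scaled_walk xi T n) in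
      let Cbst := (1 + T) * (2 + sigma) * C
                  * expR (4 * (beta + 1) ^+ 2 * sigma ^+ 2 * T) in
      (* (iii) *)
      forall (t x : R) (k : nat), (k < n./2)%N ->
        grid T n k <= t -> t < grid T n k.+1 ->
        (`| un t x - u t x | <=
          (Cbst / (n%:R `^ (alpha / 2) * (T - grid T n k) `^ (alpha / 2))
           * expR ((beta + 1) * `|x|))%:E)%E).
Proof.
split.
  move=> _ beta b0 hg; have [C C0 bound] := value_fun_GBV b0 mg hg.
  exists C; split=> // S sigma n S0 s0 n0 nodd d Omega P W xi hW hxi u un Cbst.
  split=> [t x t0 tS _|k x kn]; first exact: (bound S sigma n S0 s0 n0 nodd _ _ _ _ _ hW hxi).
  apply: (bound S sigma n S0 s0 n0 nodd _ _ _ _ _ hW hxi).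
    by rewrite /grid !mulr_ge0 ?invr_ge0// ltW.
  have nR : 0 < n%:R :> R by rewrite ltr0n.
  rewrite /grid ltr_pdivrMr// mulrC ltr_pM2l//.
  by rewrite -natrM ltr_nat mul2n -(even_halfK nodd) ltn_double.
move=> alpha al0 al1 hg; have [C C0 bound] := value_fun_hoelder al0 al1 mg hg.
by exists C; split.
Qed.
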